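(* (i) If $D$ is a 2-connected digraph with $\alpha(D)\le 2$, then $D$ contains a Hamilton orcycle with at most five backward arcs. (ii) There is a 2-connected digraph $D$ with $\alpha(D)\le 2$ which has no Hamilton orcycle with less than four backward arcs.
   Context: Digraphs are finite, without loops or parallel arcs; two opposite arcs $xy$, $yx$ may both be present. $D$ has vertex set $V(D)$ and arc set $A(D)$. $D$ is 2-connected if its underlying undirected multigraph $UG(D)$ (replace each arc $xy$ by an edge between $x$ and $y$) is 2-connected, i.e. it has at least three vertices, is connected, and remains connected after deleting any one vertex. The independence number $\alpha(D)$ is the maximum integer $k$ such that $D$ has $k$ vertices with no arc between any two of them. An orcycle (oriented cycle) in $D$ is a cyclic sequence $C=x_1x_2\dots x_px_1$ ($p\ge 3$) of distinct vertices such that for every $i\in\{1,\dots,p\}$ (indices modulo $p$) at least one of $x_ix_{i+1}$, $x_{i+1}x_i$ is in $A(D)$. If $x_ix_{i+1}\in A(D)$, then $x_ix_{i+1}$ is a forward arc of $C$; otherwise $x_{i+1}x_i$ is a backward arc of $C$. Thus the number of backward arcs of $C$ (with its given direction of traversal) is the number of $i\in\{1,\dots,p\}$ with $x_ix_{i+1}\notin A(D)$. An orcycle is Hamilton if it contains all vertices of $D$. *)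

(* Defs.v *)
From mathcomp Require Import all_boot.

Set Implicit Arguments.
Unset Strict Implicit.
Unset Printing Implicit Defensive.

Record digraph := Digraph {
  vertex :> finType;
  arc : rel vertex;
  arc_irrefl : irreflexive arc
}.

Section Digraph.

Variable D : digraph.

(* Adjacency in the underlying multigraph UG(D). Edge multiplicities play no
   role in connectivity, so a relation suffices. *)
Definition adj : rel D := [rel x y | arc x y || arc y x].

(* UG(D)[A], the subgraph of UG(D) induced by A, is connected. *)
Definition connected_in (A : {set D}) : Prop :=
  {in A &, forall x y, connect [rel u v | [&& u \in A, v \in A & adj u v]] x y}.

Definition two_connected : Prop :=
  [/\ 3 <= #|D|, connected_in [set: D] & forall v : D, connected_in [set~ v]].

Definition independent (S : {set D}) : bool :=
  [forall x in S, forall y in S, ~~ arc x y].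

Definition independence_number : nat :=
  \max_(S : {set D} | independent S) #|S|.

(* The sequence [:: x_1; ...; x_p] stands for the cyclic sequence
   x_1 x_2 ... x_p x_1, traversed in this direction. *)
Definition orcycle (c : seq D) : Prop :=
  [/\ 3 <= size c, uniq c & cycle adj c].

Definition hamilton_orcycle (c : seq D) : Prop :=
  orcycle c /\ forall x : D, x \in c.

(* next c x_i = x_(i+1), with indices modulo p, since c has no repetitions. *)
Definition backward_arcs (c : seq D) : nat :=
  count (fun x => ~~ arc x (next c x)) c.

End Digraph.

(* Main.v *)
(* A cycle that splits into k directed paths has at most k backward arcs, so one looks for a
   cyclic arrangement of at most five directed paths with adjacent consecutive ends.

   Upper bound. Let u have minimum degree, let Y be the clique of its non-neighbours, X the set
   of vertices without neighbour in Y and S the remaining vertices. Then X is a clique containing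
   u, minimality of the degree makes X complete to S, and every vertex of S has a neighbour in Y.
   A vertex adjacent to all of a directed path can be inserted into it, so X can be absorbed by
   the directed paths covering S, and Y can be traversed between any two of its vertices with
   one directed path and two single vertices. By the argument of Gallai and Milgram, either S has
   a Hamilton directed path, or it is covered by two directed paths P and Q with nonadjacent
   heads and nonadjacent ends, up to a common initial stem A and a common final stem B. Two
   nonadjacent vertices of S have all of Y as neighbours between them, so that Y can be traversed
   from one to the other with two directed paths. Otherwise Y is inserted at one junction of the
   directed paths covering S and X at another one; this fails only if some vertex of X dominates
   the one side of the junction and is dominated by the other, and comparing the obstructions at
   several junctions gives a contradiction.

   Lower bound. Two copies of a tournament on four vertices are joined by two disjoint arcs. *)

From mathcomp Require Import all_boot.
From mathcomp Require Import zify.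
Require Import Defs.

Set Implicit Arguments.
Unset Strict Implicit.
Unset Printing Implicit Defensive.

(** Lists are permutations of each other when every predicate has the same count on both. Counts are
    additive over concatenation, so such goals become linear arithmetic. *)
Ltac count_lia :=
  do 6 rewrite /= ?count_cat;
  repeat match goal with
  | |- context [@count ?T ?p ?s] => generalize (@count T p s)
  | |- context [nat_of_bool ?b] => generalize (nat_of_bool b)
  end; clear; lia.

Tactic Notation "perm_lia" := apply/permP => ?; count_lia.
Tactic Notation "perm_lia" constr(H) :=
  let p := fresh "p" in apply/permP => p; move: (permP H p); count_lia.
Tactic Notation "perm_lia" constr(H) constr(K) :=
  let p := fresh "p" in apply/permP => p; move: (permP H p) (permP K p); count_lia.
Tactic Notation "perm_lia" constr(H) constr(K) constr(L) :=
  let p := fresh "p" in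
  apply/permP => p; move: (permP H p) (permP K p) (permP L p); count_lia.

(** * Orpaths, cliques and insertion *)

Definition back (T : Type) (r : rel T) (x : T) (s : seq T) : nat :=
  sumn (pairmap (fun a b => ~~ r a b : nat) x s).

Lemma back_cat (T : Type) (r : rel T) (x : T) (s t : seq T) :
  back r x (s ++ t) = back r x s + back r (last x s) t.
Proof. by rewrite /back pairmap_cat sumn_cat. Qed.

Lemma back_eq0 (T : Type) (r : rel T) (x : T) (s : seq T) : (back r x s == 0) = path r x s.
Proof.
by elim: s x => //= y s IHs x; rewrite /back /= addn_eq0 -/(back r y s) IHs eqb0 negbK.
Qed.

Lemma count_next (T : eqType) (r : rel T) (x : T) (s : seq T) : uniq (x :: s) ->
  count (fun y => ~~ r y (next (x :: s) y)) (x :: s) = back r x (rcons s x).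
Proof.
(* The vertex that closes the cycle is separated from the first one, so that the induction can move
   the start. *)
rewrite /next /back; move: {2 6}x => x0; elim: s x => [|y s IHs] x /=.
  by rewrite eqxx.
move=> /andP[xys Uys]; rewrite eqxx -IHs //=; congr (_ + (_ + _)).
  by rewrite ifN //; apply: contraNneq xys => ->; exact: mem_head.
apply: eq_in_count => z zs; rewrite ifN //.
by apply: contraNneq xys => <-; rewrite inE zs orbT.
Qed.

Section Orpaths.

Variable D : digraph.

Implicit Types (l m : seq D) (a b x y z : D).

(* A list of vertices stands for a multiset: an orpath is known only by its
   support up to permutation, its ends and a bound on its backward arcs. *)
Definition dipath l x y : Prop :=
  exists s, [/\ perm_eq (x :: s) l, path (@arc D) x s & last x s = y].

Definition orpath l x y (k : nat) : Prop :=
  exists s, [/\ perm_eq (x :: s) l, path (@adj D) x s, last x s = y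
              & back (@arc D) x s <= k].

Lemma adjC : symmetric (@adj D).
Proof. by move=> x y; rewrite /adj /= orbC. Qed.

Lemma arc_adj x y : arc x y -> adj x y.
Proof. by rewrite /adj /= => ->. Qed.

Lemma adj_arcN x y : adj x y -> ~~ arc x y -> arc y x.
Proof. by move=> /orP[->|]. Qed.

Lemma dipath_orpath l x y : dipath l x y -> orpath l x y 0.
Proof.
case=> s [sl xs <-]; exists s; split=> //; first exact: (sub_path arc_adj).
by rewrite leqn0 back_eq0.
Qed.

Lemma dipath_perm l m x y : perm_eq l m -> dipath l x y -> dipath m x y.
Proof. by move=> lm [s [sl xs <-]]; exists s; split=> //; apply: perm_trans lm. Qed.

Lemma orpath_perm l m x y k : perm_eq l m -> orpath l x y k -> orpath m x y k.
Proof. by move=> lm [s [sl xs <- bs]]; exists s; split=> //; apply: perm_trans lm. Qed.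

Lemma orpath_le l x y k k' : k <= k' -> orpath l x y k -> orpath l x y k'.
Proof. by move=> kk' [s [sl xs <- bs]]; exists s; split=> //; apply: leq_trans kk'. Qed.

Lemma dipath1 x : dipath [:: x] x x.
Proof. by exists [::]. Qed.

Lemma orpath1 x : orpath [:: x] x x 0.
Proof. exact: dipath_orpath (dipath1 x). Qed.

Lemma dipath_head l x y : dipath l x y -> x \in l.
Proof. by case=> s [sl _ _]; rewrite -(perm_mem sl) mem_head. Qed.

Lemma dipath_last l x y : dipath l x y -> y \in l.
Proof. by case=> s [sl _ <-]; rewrite -(perm_mem sl) mem_last. Qed.

Lemma dipath_cat l m x y x' y' :
  dipath l x y -> dipath m x' y' -> arc y x' -> dipath (l ++ m) x y'.
Proof.
move=> [s [sl xs <-]] [t [tm yt <-]] yx'; exists (s ++ x' :: t); split.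
- by rewrite -cat_cons perm_cat.
- by rewrite cat_path xs /= yx'.
- by rewrite last_cat.
Qed.

Lemma orpath_cat_le l m x y x' y' k k' n :
  orpath l x y k -> orpath m x' y' k' -> adj y x' -> k + k' + ~~ arc y x' <= n ->
  orpath (l ++ m) x y' n.
Proof.
move=> [s [sl xs ys bs]] [t [tm yt <- bt]] yx' kn; exists (s ++ x' :: t); split.
- by rewrite -cat_cons perm_cat.
- by rewrite cat_path xs ys /=; rewrite /= in yx' *; rewrite yx'.
- by rewrite last_cat.
- apply: leq_trans kn; rewrite back_cat ys /back /= -!/(back _ _ _); lia.
Qed.

Lemma orpath_cat l m x y x' y' k k' :
  orpath l x y k -> orpath m x' y' k' -> adj y x' -> orpath (l ++ m) x y' (k + k').+1.
Proof. by move=> ls mt yx'; apply: orpath_cat_le ls mt yx' _; case: (arc _ _) => /=; lia. Qed.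

Definition good_cycle : Prop :=
  exists c : seq D, hamilton_orcycle c /\ backward_arcs c <= 5.

(** The closing step from [y] to [x] adds at most one backward arc to the four allowed here. *)
Lemma orpath_closed l x y k : 2 < #|D| -> perm_eq l (enum D) ->
  orpath l x y k -> k <= 4 -> adj y x -> good_cycle.
Proof.
move=> D3 lD [s [sl xs ys bs]] k4 yx; exists (x :: s).
have sD : perm_eq (x :: s) (enum D) := perm_trans sl lD.
have Us : uniq (x :: s) by rewrite (perm_uniq sD) enum_uniq.
split; first split; first split=> //.
- by rewrite (perm_size sD) -cardE.
- by rewrite /= rcons_path xs ys.
- by move=> z; rewrite (perm_mem sD) mem_enum.
rewrite /backward_arcs count_next // -cats1 back_cat.
by move: bs k4; rewrite [back _ _ [:: x]]/back /= addn0; case: (arc _ _) => /=; lia.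
Qed.

(** The place is right after the last vertex with an arc to [z]: the next vertex, if any, is
    adjacent to [z] but has no arc to it, hence receives one from [z]. The head stays. *)
Lemma dipath_insert_after l x y z : dipath l x y ->
  all (adj z) l -> has (fun a => arc a z) l ->
  exists2 y', dipath (z :: l) x y' & y' = y \/ y' = z.
Proof.
case=> s [sl xs <-]; rewrite -(perm_all _ sl) -(perm_has _ sl) => adz haz.
suff [s' [s'l xs' ls']] : exists s', [/\ perm_eq (x :: s') (z :: x :: s),
    path (@arc D) x s' & last x s' = last x s \/ last x s' = z].
  exists (last x s') => //; exists s'; split=> //.
  by apply: perm_trans s'l _; rewrite perm_cons.
elim: s x xs adz haz {sl} => [|y' s IHs] x.
  move=> _ _; rewrite /= orbF => xz; exists [:: z]; split=> //=; [|by rewrite xz|by right].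
  perm_lia.
rewrite [path _ _ _]/= => /andP[xy' ys] /andP[zx azs].
have [haz _|nhaz] := boolP (has (fun a => arc a z) (y' :: s)).
  have [s' [s'l ps' ls']] := IHs y' ys azs haz.
  exists (y' :: s'); rewrite /= xy'; split=> //.
  by perm_lia s'l.
rewrite -[has _ _]/(arc x z || has (fun a => arc a z) (y' :: s)) (negbTE nhaz) orbF => xz.
have zy' : arc z y'.
  by move: azs nhaz => /= /andP[/orP[//|->]].
by exists [:: z, y' & s]; rewrite /= xz zy'; split=> //; [perm_lia|left].
Qed.

(** Mirror image: [z] goes right before the first vertex that receives an arc from it, and the end
    stays. *)
Lemma dipath_insert_before l x y z : dipath l x y ->
  all (adj z) l -> has (arc z) l ->
  exists2 x', dipath (z :: l) x' y & x' = x \/ x' = z.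
Proof.
case=> s [sl xs ys]; rewrite -(perm_all _ sl) -(perm_has _ sl) => adz haz.
suff [x' [s' [s'l xs' ls' xx']]] : exists x' s', [/\ perm_eq (x' :: s') (z :: x :: s),
    path (@arc D) x' s', last x' s' = last x s & x' = x \/ x' = z].
  exists x' => //; exists s'; split=> //; last by rewrite ls'.
  by apply: perm_trans s'l _; rewrite perm_cons.
elim: s x xs adz haz {sl ys} => [|y' s IHs] x.
  by move=> _ _; rewrite /= orbF => zx; exists z, [:: x]; split; rewrite /= ?zx //; right.
rewrite [path _ _ _]/= => /andP[xy' ys] /andP[zx azs].
have [zx1 _|nzx] := boolP (arc z x).
  by exists z, [:: x, y' & s]; rewrite /= zx1 xy'; split=> //; right.
rewrite -[has _ _]/(arc z x || has (arc z) (y' :: s)) (negbTE nzx) => haz.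
have [x' [s' [s'l ps' ls' xx']]] := IHs y' ys azs haz.
exists x, (x' :: s'); split=> //=; last by left.
- by perm_lia s'l.
- by rewrite ps' andbT; case: xx' => ->; rewrite // adj_arcN.
Qed.

(** * Absorbing and traversing cliques *)

Definition clique l := pairwise (@adj D) l.
Definition complete l m := allrel (@adj D) l m.

Lemma completeC l m : complete l m = complete m l.
Proof. by rewrite /complete allrelC; apply: eq_allrel => x y; rewrite adjC. Qed.

Lemma complete_cons l m x : complete (x :: l) m = all (adj x) m && complete l m.
Proof. exact: allrel_consl. Qed.

Lemma complete_catr l m m' : complete l (m ++ m') = complete l m && complete l m'.
Proof. exact: allrel_catr. Qed.

Lemma complete1r l x : complete l [:: x] = all (adj x) l.
Proof. by rewrite completeC complete_cons /= andbT. Qed.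

Lemma clique_perm l m : perm_eq l m -> clique l = clique m.
Proof.
have imp (s t : seq D) : perm_eq s t -> clique s -> clique t.
  apply: (@catCA_perm_ind _ clique) => {s t}s1 s2 s3; rewrite /clique !pairwise_cat !allrel_catr.
  case/and3P=> /andP[s12 s13] ps1 /and3P[s23 ps2 ps3].
  by rewrite -/(complete s2 s1) completeC /complete s12 s13 ps1 s23 ps2 ps3.
by move=> lm; apply/idP/idP; apply: imp; rewrite // perm_sym.
Qed.

Lemma clique_cat l m : clique (l ++ m) = [&& complete l m, clique l & clique m].
Proof. exact: pairwise_cat. Qed.

(** Greedy insertion: since [X] is a clique, its remaining vertices are also adjacent to the
    absorbed ones, so insertion can go on until no remaining vertex receives an arc from the
    path. *)
Lemma dipath_grow_after X l x y : clique X -> complete X l -> dipath l x y ->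
  exists X1 X2 y', [/\ perm_eq (X1 ++ X2) X, dipath (l ++ X1) x y', y' \in y :: X1
    & forall e z, e \in l ++ X1 -> z \in X2 -> ~~ arc e z].
Proof.
have [n szX] := ubnP (size X).
elim: n => // n IHn in X l y szX *; move=> cX cXl lxy.
have [/hasP[z zX haz]|nh] := boolP (has (fun z => has (fun e => arc e z) l) X); last first.
  exists [::], X, y; rewrite cats0 mem_head; split=> // e z el zX.
  by apply: contraNN nh => ez; apply/hasP; exists z => //; apply/hasP; exists e.
have XE := perm_to_rem zX.
have [y1 lxy1 y1E] : exists2 y', dipath (z :: l) x y' & y' = y \/ y' = z.
  by apply: dipath_insert_after lxy _ haz; exact: (allP cXl).
have := cX; rewrite (clique_perm XE) /= => /andP[adz cX'].
have cXl' : complete (rem z X) (z :: l).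
  rewrite completeC complete_cons adz /= completeC.
  by apply/allP=> w /mem_rem; apply: (allP cXl).
have szX' : size (rem z X) < n.
  by rewrite size_rem //; move: szX zX; case: (X).
have [X1 [X2 [y' [pX d y'X1 nar]]]] := IHn _ _ _ szX' cX' cXl' lxy1.
exists (z :: X1), X2, y'; split.
- by rewrite (permPr XE) /= perm_cons.
- by apply: dipath_perm d; perm_lia.
- by move: y'X1; rewrite !inE => /orP[/eqP->|->]; [case: y1E => ->; rewrite eqxx ?orbT|rewrite !orbT].
- move=> e w el; apply: nar; move: el; rewrite !(inE, mem_cat).
  by case/or3P=> ->; rewrite ?orbT.
Qed.

Lemma dipath_grow_before X l x y : clique X -> complete X l -> dipath l x y ->
  exists X1 X2 x', [/\ perm_eq (X1 ++ X2) X, dipath (l ++ X1) x' y, x' \in x :: X1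
    & forall e z, e \in l ++ X1 -> z \in X2 -> ~~ arc z e].
Proof.
have [n szX] := ubnP (size X).
elim: n => // n IHn in X l x szX *; move=> cX cXl lxy.
have [/hasP[z zX haz]|nh] := boolP (has (fun z => has (arc z) l) X); last first.
  exists [::], X, x; rewrite cats0 mem_head; split=> // e z el zX.
  by apply: contraNN nh => ez; apply/hasP; exists z => //; apply/hasP; exists e.
have XE := perm_to_rem zX.
have [x1 lxy1 x1E] : exists2 x', dipath (z :: l) x' y & x' = x \/ x' = z.
  by apply: dipath_insert_before lxy _ haz; exact: (allP cXl).
have := cX; rewrite (clique_perm XE) /= => /andP[adz cX'].
have cXl' : complete (rem z X) (z :: l).
  rewrite completeC complete_cons adz /= completeC.
  by apply/allP=> w /mem_rem; apply: (allP cXl).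
have szX' : size (rem z X) < n.
  by rewrite size_rem //; move: szX zX; case: (X).
have [X1 [X2 [x' [pX d x'X1 nar]]]] := IHn _ _ _ szX' cX' cXl' lxy1.
exists (z :: X1), X2, x'; split.
- by rewrite (permPr XE) /= perm_cons.
- by apply: dipath_perm d; perm_lia.
- by move: x'X1; rewrite !inE => /orP[/eqP->|->]; [case: x1E => ->; rewrite eqxx ?orbT|rewrite !orbT].
- move=> e w el; apply: nar; move: el; rewrite !(inE, mem_cat).
  by case/or3P=> ->; rewrite ?orbT.
Qed.

Lemma clique_adj l x y : clique l -> x \in l -> y \in l -> x != y -> adj x y.
Proof.
move=> cl xl yl xy; have pl := perm_to_rem xl.
move: cl yl; rewrite (clique_perm pl) (perm_mem pl) inE eq_sym (negbTE xy) /=.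
by case/andP=> /allP h _ /h.
Qed.

(** Vertices left over by [dipath_grow_after] receive no arc from the path, hence have arcs to all
    of it, so that [dipath_grow_before] absorbs every one of them. *)
Lemma dipath_grow X l x y : clique X -> complete X l -> dipath l x y ->
  exists x' y', [/\ dipath (l ++ X) x' y', x' \in x :: X & y' \in y :: X].
Proof.
move=> cX cXl lxy; have [X1 [X2 [y' [pX d y'X1 nar]]]] := dipath_grow_after cX cXl lxy.
have := cX; rewrite -(clique_perm pX) clique_cat => /and3P[c12 _ cX2].
have cX2l : complete X2 (l ++ X1).
  apply/allrelP=> z e zX2; rewrite mem_cat => /orP[el|eX1]; last first.
    by rewrite adjC; exact: (allrelP c12).
  by apply: (allrelP cXl); rewrite // -(perm_mem pX) mem_cat zX2 orbT.
have [X3 [X4 [x' [pX2 d' x'X3 nar']]]] := dipath_grow_before cX2 cX2l d.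
have X4E : X4 = [::].
  case: X4 pX2 nar' => // z X4 pX2 nar'; have zX2 : z \in X2.
    by rewrite -(perm_mem pX2) mem_cat mem_head orbT.
  have xd := dipath_head d.
  have /negP[] : ~~ arc z x by apply: nar'; rewrite ?mem_head // mem_cat xd.
  by apply: adj_arcN (nar _ _ xd zX2); rewrite adjC; exact: (allrelP cX2l).
rewrite {}X4E cats0 in pX2; exists x', y'; split.
- by apply: dipath_perm d'; perm_lia pX pX2.
- move: x'X3; rewrite !inE -(perm_mem pX) mem_cat -(perm_mem pX2) => /orP[->//|->].
  by rewrite !orbT.
- by move: y'X1; rewrite !inE -(perm_mem pX) mem_cat => /orP[->//|->]; rewrite orbT.
Qed.

(* [X] is absorbed greedily, first at the end of [E] and then at the front of [F]; the vertex
   [z] is one that neither of them absorbs. *)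
Lemma dipath_junction X E F e e' f f' : clique X -> complete X E -> complete X F ->
  dipath E e e' -> dipath F f f' -> adj e' f ->
  orpath (E ++ F ++ X) e f' 1 \/
  exists z, [/\ z \in X, forall a, a \in E -> ~~ arc a z,
    forall a, a \in F -> ~~ arc z a &
    forall a x, a \in E -> x \in X -> arc a x -> ~~ arc x z].
Proof.
move=> cX cXE cXF dE dF e'f.
have [X1 [X2 [e1 [pX d1 e1X1 nar1]]]] := dipath_grow_after cX cXE dE.
have := cX; rewrite -(clique_perm pX) clique_cat => /and3P[c12 _ cX2].
have X2X : {subset X2 <= X} by move=> z zX2; rewrite -(perm_mem pX) mem_cat zX2 orbT.
have X1X : {subset X1 <= X} by move=> z zX2; rewrite -(perm_mem pX) mem_cat zX2.
have cX2F : complete X2 F by apply/allrelP=> z a /X2X; exact: (allrelP cXF).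
have [X3 [X4 [f1 [pX2 d2 f1X3 nar2]]]] := dipath_grow_before cX2 cX2F dF.
have X3X2 : {subset X3 <= X2} by move=> z zX3; rewrite -(perm_mem pX2) mem_cat zX3.
case: X4 pX2 nar2 => [|z X4] pX2 nar2; [left|right].
  rewrite cats0 in pX2.
  apply: (orpath_perm (l := (E ++ X1) ++ (F ++ X3))); first by perm_lia pX pX2.
  apply: (orpath_cat (k := 0) (k' := 0)) (dipath_orpath d1) (dipath_orpath d2) _.
  move: e1X1 f1X3; rewrite !inE => /orP[/eqP->|e1X1] /orP[/eqP->|f1X3] //.
  - by rewrite adjC; apply: (allrelP cXE) (dipath_last dE); apply/X2X/X3X2.
  - by apply: (allrelP cXF) (dipath_head dF); exact: X1X.
  - by apply: (allrelP c12) => //; exact: X3X2.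
have zX4 : z \in z :: X4 by exact: mem_head.
have zX2 : z \in X2 by rewrite -(perm_mem pX2) mem_cat zX4 orbT.
exists z; split=> [|a aE|a aF|a x aE xX ax]; first exact: X2X.
- by apply: nar1; rewrite ?mem_cat ?aE.
- by apply: nar2; rewrite ?mem_cat ?aF.
(* A vertex [x] that receives an arc from [E] cannot be left in [X2]; so it lies on the path grown
   from [E], which has no arc to [z]. *)
move: xX; rewrite -(perm_mem pX) mem_cat => /orP[xX1|xX2].
  by apply: nar1; rewrite ?mem_cat ?xX1 ?orbT.
by have /negP[] : ~~ arc a x by apply: nar1; rewrite ?mem_cat ?aE.
Qed.

(** Redei's theorem: one vertex of the clique absorbs all others. *)
Lemma dipath_clique X : clique X -> X != [::] -> exists x y, dipath X x y.
Proof.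
case: X => // x X /= /andP[aX cX] _.
have cXx : complete X [:: x] by rewrite completeC complete_cons aX.
by have [x' [y' [d _ _]]] := dipath_grow cX cXx (dipath1 x); exists x', y'.
Qed.

(** A Hamilton directed path of the other vertices, if there are any, is placed between [x] and [y];
    only its two junctions can be backward. *)
Lemma orpath_clique l x y : clique l -> x \in l -> y \in l -> x != y -> orpath l x y 2.
Proof.
move=> cl xl yl xy; have plx := perm_to_rem xl.
have yl' : y \in rem x l.
  by move: yl; rewrite (perm_mem plx) inE eq_sym (negbTE xy).
have ply := perm_to_rem yl'; set r := rem y _ in ply.
have pl : perm_eq l (x :: y :: r) by perm_lia plx ply.
move: cl; rewrite (clique_perm pl) => /and3P[/= /andP[xy' xr] yr cr].
have [r0|rn0] := eqVneq r [::].
  apply: (orpath_perm (l := [:: x] ++ [:: y])); first by rewrite (permPr pl) r0.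
  by apply: orpath_le (orpath_cat (orpath1 x) (orpath1 y) xy').
have [a [b rab]] := dipath_clique cr rn0.
apply: (orpath_perm (l := [:: x] ++ r ++ [:: y])); first by perm_lia pl.
apply: orpath_cat (orpath1 x) (orpath_cat (dipath_orpath rab) (orpath1 y) _) _.
  by rewrite adjC; apply: (allP yr); exact: dipath_last rab.
by apply: (allP xr); exact: dipath_head rab.
Qed.

Lemma dipath_first_change (P : pred D) l x y : dipath l x y -> P x -> ~~ all P l ->
  exists l1 l2 a b, [/\ perm_eq (l1 ++ l2) l, dipath l1 x a /\ dipath l2 b y,
    arc a b, all P l1 & ~~ P b].
Proof.
case=> s [sl xs ys] Px; rewrite -(perm_all _ sl) /= Px /= => nPs.
suff [s1 [b [t [sE Ps1 nPb]]]] : exists s1 b t, [/\ s = s1 ++ b :: t, all P s1 & ~~ P b].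
  exists (x :: s1), (b :: t), (last x s1), b; move: xs ys sl; rewrite sE cat_path last_cat /=.
  case/and3P=> xs1 ab bt ys sl; split=> //; last by rewrite /= Px.
  by split; [exists s1|exists t].
elim: s nPs {xs ys sl} => //= b s IHs; rewrite negb_and.
have [Pb|nPb] /= := boolP (P b); last by exists [::], b, s.
by move=> /IHs[s1 [b' [t [-> Ps1 nPb']]]]; exists (b :: s1), b', t; split; rewrite //= Pb.
Qed.

Lemma dipath_last_change (P : pred D) l x y : dipath l x y -> P y -> ~~ all P l ->
  exists l1 l2 a b, [/\ perm_eq (l1 ++ l2) l, dipath l1 x a /\ dipath l2 b y,
    arc a b, ~~ P a & all P l2].
Proof.
case=> s [sl xs <-] Py; rewrite -(perm_all _ sl) => nPs.
suff [s1 [a [b [t [sE nPa Pt xs1 [ab bt lt]]]]]] : exists s1 a b t,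
    [/\ x :: s = s1 ++ b :: t, ~~ P a, all P (b :: t), dipath s1 x a &
    [/\ arc a b, path (@arc D) b t & last b t = last x s]].
  by exists s1, (b :: t), a, b; rewrite -sE; split=> //; split=> //; exists t.
elim: s x xs Py nPs {sl} => [|c s IHs] x /=; first by move=> _ ->.
move=> /andP[xc cs] Py; rewrite negb_and.
have [Ps|nPs _] := boolP (all P (c :: s)); last first.
  have [s1 [a [b [t [sE nPa Pt ds1 [ab bt lt]]]]]] := IHs c cs Py nPs.
  exists (x :: s1), a, b, t; rewrite sE; split=> //.
  exact: (dipath_cat (dipath1 x) ds1 xc).
by rewrite -[P c && _]/(all P (c :: s)) Ps orbF => nPx; exists [:: x], x, c, s; split=> //; exact: dipath1.
Qed.

(** If a Hamilton directed path of [Y] has a wrong end, it is cut at an arc from [a] in [P'] to [b]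
    in [P] and its two pieces are exchanged. Such an arc occurs at the last vertex of [P'] or at the
    first vertex of [P], because [P] and [P'] cover [Y]. *)
Lemma orpath_clique_cover (P P' : pred D) Y : clique Y ->
  {in Y, forall y, P y || P' y} -> has P Y -> has P' Y ->
  exists y y', [/\ P y, P' y' & orpath Y y y' 1].
Proof.
move=> cY PP' hP hP'; have Yn : Y != [::] by case: (Y) hP.
have [y0 [y1 d]] := dipath_clique cY Yn.
have rot l1 l2 a b : perm_eq (l1 ++ l2) Y -> dipath l1 y0 a -> dipath l2 b y1 ->
    P' a -> P b -> exists y y', [/\ P y, P' y' & orpath Y y y' 1].
  move=> pY d1 d2 P'a Pb; exists b, a; split=> //.
  apply: (orpath_perm (l := l2 ++ l1)); first by perm_lia pY.
  apply: orpath_cat (dipath_orpath d2) (dipath_orpath d1) _.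
  move: cY; rewrite -(clique_perm pY) clique_cat completeC => /and3P[/allrelP c21 _ _].
  by apply: c21; [exact: dipath_last d2|exact: dipath_head d1].
have [Py0|nPy0] := boolP (P y0).
  have [P'y1|nP'y1] := boolP (P' y1).
    by exists y0, y1; split=> //; exact: orpath_le (dipath_orpath d).
  have hP2 : ~~ all (predC P') Y by rewrite all_predC negbK.
  have [l1 [l2 [a [b [pY [d1 d2] _ P'a /allP nP'b]]]]] := dipath_last_change d nP'y1 hP2.
  have bl2 := dipath_head d2; have bY : b \in Y by rewrite -(perm_mem pY) mem_cat bl2 orbT.
  have Pb : P b by have := PP' b bY; rewrite (negbTE (nP'b b bl2)) orbF.
  by apply: rot pY d1 d2 _ Pb; move: P'a; rewrite negbK.
have hP2 : ~~ all (predC P) Y by rewrite all_predC negbK.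
have [l1 [l2 [a [b [pY [d1 d2] _ /allP nPa Pb]]]]] := dipath_first_change (P := predC P) d nPy0 hP2.
have al1 := dipath_last d1; have aY : a \in Y by rewrite -(perm_mem pY) mem_cat al1.
apply: rot pY d1 d2 _ _; last by move: Pb; rewrite negbK.
by have := PP' a aY; rewrite (negbTE (nPa a al1)).
Qed.

(** If [y0] is an end of a Hamilton directed path of [Y], the arc at this end is cut off and
    attached at the opposite end, which makes [y0] an inner vertex. *)
Lemma orpath_clique_avoid Y y0 : clique Y -> uniq Y -> 2 < size Y ->
  exists y y', [/\ y \in Y, y' \in Y, y != y0, y' != y0 & orpath Y y y' 1].
Proof.
move=> cY UY szY; have Yn : Y != [::] by case: (Y) szY.
have [x [z [s [sY xs ls]]]] := dipath_clique cY Yn.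
have memY := perm_mem sY.
have Us : uniq (x :: s) by rewrite (perm_uniq sY).
have szs : 2 < size (x :: s) by rewrite (perm_size sY).
have cs : clique (x :: s) by rewrite (clique_perm sY).
have [xy0|xy0] := eqVneq x y0.
  case: s sY xs ls memY Us szs cs => [|a [|b t]] // sY xs ls memY Us _ cs.
  have [xa ab bt] := and3P xs; have zt : z \in b :: t by rewrite -ls /= mem_last.
  exists b, a; rewrite -!memY !inE !eqxx !orbT.
  have [xnot anot _] := and3P Us.
  split=> //.
  - by apply: contraNneq xnot => E; rewrite xy0 -E !inE eqxx orbT.
  - by apply: contraNneq xnot => E; rewrite xy0 -E !inE eqxx.
  apply: (orpath_perm (l := (b :: t) ++ [:: x; a])); first by rewrite -(permPr sY); perm_lia.
  apply: (orpath_cat (k := 0) (k' := 0) (y := z) (x' := x)).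
  - by apply: dipath_orpath; exists t.
  - by apply: dipath_orpath; exists [:: a]; rewrite /= xa.
  apply: clique_adj cs _ _ _; rewrite ?mem_head //; first by rewrite 2!in_cons zt !orbT.
  by apply: contraNneq xnot => <-; rewrite in_cons zt orbT.
have [zy0|zy0] := eqVneq z y0; last first.
  exists x, z; rewrite -!memY mem_head -ls mem_last; split=> //; first by rewrite ls.
  by apply: orpath_le (dipath_orpath _) => //; exists s; rewrite ls.
case/lastP: s sY xs ls memY Us szs cs zy0 => [|s c] // sY xs; rewrite last_rcons => <- {z}.
case/lastP: s sY xs => [|s a] // sY; rewrite !rcons_path last_rcons => /andP[/andP[xs sa] az].
move=> memY Us _ cs zy0; move: c zy0 sY az memY Us cs => z zy0 sY az memY Us cs.
have pY : perm_eq ([:: a; z] ++ x :: s) Y by rewrite -(permPr sY) -!cats1; perm_lia.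
have := Us; rewrite (perm_uniq sY) -(perm_uniq pY) /= !inE => /and3P[].
rewrite !negb_or => /and3P[az' ax as_] /andP[zx zs] _.
have lxs := mem_last x s.
exists a, (last x s); rewrite -!(perm_mem pY) mem_cat mem_head [_ \in _ ++ _]mem_cat lxs orbT -zy0.
split=> //; first by apply: contraTneq lxs => ->; rewrite inE negb_or zx.
apply: orpath_perm pY _; apply: (orpath_cat (k := 0) (k' := 0) (y := z) (x' := x)).
- by apply: dipath_orpath; exists [:: z]; rewrite /= az.
- by apply: dipath_orpath; exists s.
by apply: clique_adj cs _ _ _; rewrite ?mem_head // !(inE, mem_rcons) eqxx ?orbT.
Qed.

(** Hall's theorem for two nonempty sets: distinct representatives are missing only if both sets are
    the same singleton. *)
Lemma distinct_representatives (P P' : pred D) Y : has P Y -> has P' Y ->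
  (exists y y', [/\ y \in Y, y' \in Y, P y, P' y' & y != y']) \/
  exists2 y0, y0 \in Y & {in Y, forall y, (P y = (y == y0)) * (P' y = (y == y0))}.
Proof.
move=> /hasP[y1 Y1 Py1] /hasP[y2 Y2 Py2].
have [E|ne] := eqVneq y1 y2; last by left; exists y1, y2.
rewrite -{}E in Y2 Py2.
have [/hasP[y yY /andP[Py yy1]]|nh] := boolP (has (fun y => P y && (y != y1)) Y).
  by left; exists y, y1.
have [/hasP[y yY /andP[Py yy1]]|nh'] := boolP (has (fun y => P' y && (y != y1)) Y).
  by left; exists y1, y; rewrite eq_sym.
right; exists y1 => // y yY; have := (hasPn nh y yY, hasPn nh' y yY).
by have [->|_] := eqVneq y y1; rewrite ?Py1 ?Py2 ?andbT // => -[/negbTE-> /negbTE->].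
Qed.

(** The two junctions make up the difference between three and five. *)
Lemma orpaths_closed l m x y x' y' k k' : 2 < #|D| -> perm_eq (l ++ m) (enum D) ->
  orpath l x y k -> orpath m x' y' k' -> adj y x' -> adj y' x -> k + k' <= 3 -> good_cycle.
Proof.
move=> D3 lm ls mt yx' y'x kk'.
exact: orpath_closed D3 lm (orpath_cat ls mt yx') _ y'x.
Qed.

(** * Covering by two directed paths *)

Hypothesis adj3 : forall x y z, x != y -> y != z -> x != z -> [|| adj x y, adj y z | adj x z].

(** [take 1] gives the head of a path and nothing for an empty one, so that a cover by fewer paths
    is included. *)
Definition two_dipath_cover l (heads : seq D) : Prop :=
  exists U V, [/\ perm_eq (U ++ V) l, sorted (@arc D) U, sorted (@arc D) V &
    {subset take 1 U ++ take 1 V <= heads}].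

Lemma two_dipath_cover_perm l l' heads heads' : perm_eq l l' -> heads =i heads' ->
  two_dipath_cover l heads -> two_dipath_cover l' heads'.
Proof.
move=> ll' hh' [U [V [UV sU sV sub]]]; exists U, V; split=> //.
  exact: perm_trans ll'.
by move=> z /sub; rewrite hh'.
Qed.

(* Gallai and Milgram: keeping the heads within the given ones makes the induction work. *)
Lemma three_dipaths p P q Q r R : uniq ((p :: P) ++ (q :: Q) ++ (r :: R)) ->
  path (@arc D) p P -> path (@arc D) q Q -> path (@arc D) r R ->
  two_dipath_cover ((p :: P) ++ (q :: Q) ++ (r :: R)) [:: p; q; r].
Proof.
have [n szn] := ubnP (size P + size Q + size R).
elim: n => // n IHn in p P q Q r R szn *.
(* Without [p1], the induction gives two paths with heads among [p2], [q1], [r1]. Two distinct heads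
   are not both [r1], so [p1] can be put before [p2] or [q1]; [p2] is preferred, as it may not
   remain a head. *)
have core p1 P1 q1 Q1 r1 R1 : size P1 + size Q1 + size R1 < n.+1 ->
    uniq ((p1 :: P1) ++ (q1 :: Q1) ++ (r1 :: R1)) ->
    path (@arc D) p1 P1 -> path (@arc D) q1 Q1 -> path (@arc D) r1 R1 -> arc p1 q1 ->
    two_dipath_cover ((p1 :: P1) ++ (q1 :: Q1) ++ (r1 :: R1)) [:: p1; q1; r1].
  case: P1 => [|p2 P2] szn1 Us pP qQ rR pq.
    exists (p1 :: q1 :: Q1), (r1 :: R1); split; rewrite //= ?pq ?take0 //.
    by move=> z; rewrite !inE => /orP[]->; rewrite ?orbT.
  have [pp2 p2P] := andP pP.
  have Us2 : uniq ((p2 :: P2) ++ (q1 :: Q1) ++ (r1 :: R1)) by case/andP: Us.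
  have szn2 : size P2 + size Q1 + size R1 < n by move: szn1 => /=; clear; lia.
  have [U [V [UV sU sV sub]]] := IHn p2 P2 q1 Q1 r1 R1 szn2 Us2 p2P qQ rR.
  have UUV : uniq (U ++ V) by rewrite (perm_uniq UV).
  have ext s : sorted (@arc D) s -> {in take 1 s, forall z, arc p1 z} -> sorted (@arc D) (p1 :: s).
    by case: s => //= z s -> ->; rewrite // take0 mem_head.
  have extU : {in take 1 U, forall z, arc p1 z} -> p2 \notin take 1 V ->
      two_dipath_cover ((p1 :: p2 :: P2) ++ (q1 :: Q1) ++ (r1 :: R1)) [:: p1; q1; r1].
    move=> hU hV; exists (p1 :: U), V; split=> //; first by rewrite /= perm_cons.
      exact: ext.
    move=> z; rewrite /= take0 inE => /orP[/eqP->|zV]; first exact: mem_head.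
    have := sub z; rewrite mem_cat zV orbT => /(_ isT); rewrite !inE => /orP[/eqP zp2|->].
      by rewrite -zp2 zV in hV.
    by rewrite orbT.
  have extV : {in take 1 V, forall z, arc p1 z} -> p2 \notin take 1 U ->
      two_dipath_cover ((p1 :: p2 :: P2) ++ (q1 :: Q1) ++ (r1 :: R1)) [:: p1; q1; r1].
    move=> hV hU; exists U, (p1 :: V); split=> //; first by perm_lia UV.
      exact: ext.
    move=> z; rewrite mem_cat /= take0 inE orbC => /orP[/eqP->|zU]; first exact: mem_head.
    have := sub z; rewrite mem_cat zU => /(_ isT); rewrite !inE => /orP[/eqP zp2|->].
      by rewrite -zp2 zU in hU.
    by rewrite orbT.
  case: U V UV sU sV sub UUV extU extV => [|u U] [|v V] UV sU sV sub UUV extU extV.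
  - exact: extU.
  - have [vp2|vp2] := eqVneq v p2; last first.
      by apply: extU; rewrite //= take0 inE eq_sym.
    by apply: extV; rewrite //= take0 => z; rewrite inE => /eqP->; rewrite vp2.
  - have [up2|up2] := eqVneq u p2; last first.
      by apply: extV; rewrite //= take0 inE eq_sym.
    by apply: extU; rewrite //= take0 => z; rewrite inE => /eqP->; rewrite up2.
  rewrite /= !take0 in extU extV sub.
  have uv : u != v.
    by move: UUV => /andP[+ _]; apply: contraNneq => ->; rewrite mem_cat mem_head orbT.
  have [up2|up2] := eqVneq u p2.
    by apply: extU; [move=> z; rewrite inE => /eqP->; rewrite up2|rewrite inE -up2].
  have [vp2|vp2] := eqVneq v p2.
    by apply: extV; [move=> z; rewrite inE => /eqP->; rewrite vp2|rewrite inE eq_sym].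
  have [uq|uq] := eqVneq u q1.
    by apply: extU; [move=> z; rewrite inE => /eqP->; rewrite uq|rewrite inE eq_sym].
  have [vq|vq] := eqVneq v q1.
    by apply: extV; [move=> z; rewrite inE => /eqP->; rewrite vq|rewrite inE eq_sym].
  have := (sub u, sub v); rewrite !inE !eqxx (negbTE up2) (negbTE vp2) (negbTE uq) (negbTE vq) orbT /=.
  by case=> /(_ isT)/eqP ur /(_ isT)/eqP vr; rewrite ur vr eqxx in uv.
move=> Us pP qQ rR; have : uniq ([:: p] ++ [:: q] ++ [:: r]).
  by apply: subseq_uniq Us; rewrite !cat_subseq // sub1seq mem_head.
rewrite /= !inE negb_or andbT => /andP[/andP[pq pr] qr].
have use p1 P1 q1 Q1 r1 R1 :
    perm_eq ((p1 :: P1) ++ (q1 :: Q1) ++ (r1 :: R1)) ((p :: P) ++ (q :: Q) ++ (r :: R)) ->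
    [:: p1; q1; r1] =i [:: p; q; r] -> path (@arc D) p1 P1 -> path (@arc D) q1 Q1 ->
    path (@arc D) r1 R1 -> arc p1 q1 ->
    two_dipath_cover ((p :: P) ++ (q :: Q) ++ (r :: R)) [:: p; q; r].
  move=> pl hl pP1 qQ1 rR1 a; apply: (two_dipath_cover_perm pl hl); apply: core => //.
    by move: szn (perm_size pl); rewrite /= !size_cat /= !size_cat /=; clear; lia.
  by rewrite (perm_uniq pl).
have heads (x y z : D) : perm_eq [:: x; y; z] [:: p; q; r] -> [:: x; y; z] =i [:: p; q; r].
  exact: perm_mem.
have /or3P[/orP[]|/orP[]|/orP[]] := adj3 pq qr pr => a.
- by apply: (use p P q Q r R).
- by apply: (use q Q p P r R) => //; [perm_lia|apply: heads; perm_lia].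
- by apply: (use q Q r R p P) => //; [perm_lia|apply: heads; perm_lia].
- by apply: (use r R q Q p P) => //; [perm_lia|apply: heads; perm_lia].
- by apply: (use p P r R q Q) => //; [perm_lia|apply: heads; perm_lia].
- by apply: (use r R p P q Q) => //; [perm_lia|apply: heads; perm_lia].
Qed.

(** Vertices are added one by one; a new vertex is a third path, and [three_dipaths] brings the
    number back to two. *)
Lemma two_dipaths l : uniq l -> exists U V,
  [/\ perm_eq (U ++ V) l, sorted (@arc D) U & sorted (@arc D) V].
Proof.
elim: l => [|v l IHl]; first by exists [::], [::].
rewrite cons_uniq => /andP[vl Ul]; have [[|u U] [[|w V] [UV sU sV]]] := IHl Ul.
- by exists [:: v], [::]; rewrite perm_cons.
- by exists [:: v], (w :: V); rewrite perm_cons.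
- by exists (u :: U), [:: v]; split=> //; perm_lia UV.
have Us : uniq ([:: v] ++ (u :: U) ++ (w :: V)).
  by rewrite cat_uniq (perm_uniq UV) Ul has_sym /= orbF (perm_mem UV) vl.
have [U' [V' [UV' sU' sV' _]]] := three_dipaths Us isT sU sV.
by exists U', V'; split=> //; perm_lia UV UV'.
Qed.

(** * Stripping common stems off two directed paths *)

Lemma sorted_glue (T : Type) (r : rel T) (x : T) (s t : seq T) :
  sorted r (s ++ [:: x]) -> sorted r (x :: t) -> sorted r (s ++ x :: t).
Proof. by case: s => //= y s; rewrite !cat_path /= andbT => /andP[-> ->] ->. Qed.

(** While the two heads are adjacent, the one with an arc to the other moves to the end of the stem
    [A]. Then [A] still continues into both branches. *)
Lemma strip_heads B P Q : sorted (@arc D) (P ++ B) -> sorted (@arc D) (Q ++ B) ->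
  exists A P' Q', [/\ perm_eq (A ++ P' ++ Q') (P ++ Q), sorted (@arc D) (A ++ P' ++ B),
    sorted (@arc D) (A ++ Q' ++ B) &
    if (P', Q') is (p :: _, q :: _) then ~~ adj p q else true].
Proof.
suff strip A : sorted (@arc D) (A ++ P ++ B) -> sorted (@arc D) (A ++ Q ++ B) ->
    exists A' P' Q', [/\ perm_eq (A' ++ P' ++ Q') (A ++ P ++ Q), sorted (@arc D) (A' ++ P' ++ B),
      sorted (@arc D) (A' ++ Q' ++ B) &
      if (P', Q') is (p :: _, q :: _) then ~~ adj p q else true].
  exact: (strip [::]).
have [n szn] := ubnP (size P + size Q); elim: n => // n IHn in A P Q szn *.
case: P Q szn => [|p P] [|q Q] szn sP sQ; try by exists A, [::], [::].
- by exists A, [::], (q :: Q).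
- by exists A, (p :: P), [::].
have [/orP[pq|qp]|npq] := boolP (adj p q); last by exists A, (p :: P), (q :: Q).
- have [|||A' [P' [Q' [pl sP' sQ' ok]]]] := IHn (A ++ [:: p]) P (q :: Q).
  + by move: szn; rewrite /=; clear; lia.
  + by rewrite -catA.
  + rewrite -catA; apply: sorted_glue; last by rewrite /= pq; have /cat_sorted2[] := sQ.
    by move: sP; rewrite -[p :: P]cat1s -catA catA => /cat_sorted2[].
  by exists A', P', Q'; split=> //; perm_lia pl.
- have [|||A' [P' [Q' [pl sP' sQ' ok]]]] := IHn (A ++ [:: q]) (p :: P) Q.
  + by move: szn; rewrite /=; clear; lia.
  + rewrite -catA; apply: sorted_glue; last by rewrite /= qp; have /cat_sorted2[] := sP.
    by move: sQ; rewrite -[q :: Q]cat1s -catA catA => /cat_sorted2[].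
  + by rewrite -catA.
  by exists A', P', Q'; split=> //; perm_lia pl.
Qed.

(** Mirror image of [strip_heads]. The equations for [P] and [Q] record that only ends are removed,
    so that nonadjacent heads survive as long as both branches do. *)
Lemma strip_lasts A P Q : sorted (@arc D) (A ++ P) -> sorted (@arc D) (A ++ Q) ->
  exists B P' Q' P2 Q2, [/\ perm_eq (P' ++ Q' ++ B) (P ++ Q), sorted (@arc D) (A ++ P' ++ B),
    sorted (@arc D) (A ++ Q' ++ B), P = P' ++ P2 /\ Q = Q' ++ Q2 &
    if (P', Q') is (p :: P1, q :: Q1) then ~~ adj (last p P1) (last q Q1) else true].
Proof.
suff strip B : sorted (@arc D) (A ++ P ++ B) -> sorted (@arc D) (A ++ Q ++ B) ->
    exists B' P' Q' P2 Q2, [/\ perm_eq (P' ++ Q' ++ B') (P ++ Q ++ B),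
      sorted (@arc D) (A ++ P' ++ B'),
      sorted (@arc D) (A ++ Q' ++ B'), P = P' ++ P2 /\ Q = Q' ++ Q2 &
      if (P', Q') is (p :: P1, q :: Q1) then ~~ adj (last p P1) (last q Q1) else true].
  by have := strip [::]; rewrite !cats0.
have [n szn] := ubnP (size P + size Q); elim: n => // n IHn in B P Q szn *.
case/lastP: P szn => [|P p] szn sP sQ; first by exists B, [::], Q, [::], [::]; rewrite !cats0.
case/lastP: Q szn sQ => [|Q q] szn sQ.
  exists B, (rcons P p), [::], [::], [::]; rewrite !cats0; split=> //.
  by case: (rcons P p).
have [|npq] := boolP (adj p q); last first.
  exists B, (rcons P p), (rcons Q q), [::], [::]; rewrite !cats0; split=> //.
  have := (last_rcons p P p, last_rcons p Q q).
  by case: (rcons P p) (rcons Q q) => [|p' P'] [|q' Q'] //= [-> ->].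
rewrite !cat_rcons in sP sQ.
case/orP=> [pq|qp].
- have [|||B' [P' [Q' [P2 [Q2 [pl sP' sQ' [PE QE] ok]]]]]] := IHn (q :: B) (rcons P p) Q.
  + by move: szn; rewrite !size_rcons; clear; lia.
  + rewrite cat_rcons catA; apply: sorted_glue.
      by move: sP; rewrite -[_ :: B]cat1s !catA => /cat_sorted2[].
    by rewrite /= pq; move: sQ; rewrite catA => /cat_sorted2[].
  + by [].
  exists B', P', Q', P2, (rcons Q2 q); split=> //; last by rewrite QE rcons_cat.
  by rewrite -!cats1 in pl *; perm_lia pl.
- have [|||B' [P' [Q' [P2 [Q2 [pl sP' sQ' [PE QE] ok]]]]]] := IHn (p :: B) P (rcons Q q).
  + by move: szn; rewrite !size_rcons; clear; lia.
  + by [].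
  + rewrite cat_rcons catA; apply: sorted_glue.
      by move: sQ; rewrite -[_ :: B]cat1s !catA => /cat_sorted2[].
    by rewrite /= qp; move: sP; rewrite catA => /cat_sorted2[].
  exists B', P', Q', (rcons P2 p), Q2; split=> //; last by rewrite PE rcons_cat.
  by rewrite -!cats1 in pl *; perm_lia pl.
Qed.

Lemma sorted_dipath s x0 : s != [::] -> sorted (@arc D) s -> dipath s (head x0 s) (last x0 s).
Proof. by case: s => // x s _ xs; exists s. Qed.

(* The stems [A] and [B], stripped off as long as both heads or both ends are adjacent, may be
   empty. *)
Definition fork S A P Q B a1 a2 b1 b2 p p' q q' : Prop :=
  [/\ perm_eq (A ++ P ++ Q ++ B) S,
      [/\ dipath (A ++ P) a1 p', dipath (A ++ Q) a2 q', dipath (P ++ B) p b1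
        & dipath (Q ++ B) q b2],
      [/\ p \in P, p' \in P, q \in Q & q' \in Q], ~~ adj p q & ~~ adj p' q'].

Lemma fork_sym S A P Q B a1 a2 b1 b2 p p' q q' :
  fork S A P Q B a1 a2 b1 b2 p p' q q' -> fork S A Q P B a2 a1 b2 b1 q q' p p'.
Proof.
case=> pl [dAP dAQ dPB dQB] [pP p'P qQ q'Q] pq p'q'.
by split; rewrite ?(adjC q) ?(adjC q') //; perm_lia pl.
Qed.

(** Two directed paths covering [S] are stripped at both sides. If a branch vanishes, the stems and
    the other branch form a Hamilton directed path. *)
Lemma hamilton_dipath_or_fork S : uniq S -> S != [::] ->
  (exists x y, dipath S x y) \/
  exists A P Q B a1 a2 b1 b2 p p' q q', fork S A P Q B a1 a2 b1 b2 p p' q q'.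
Proof.
move=> US Sn; have [U [V [UV sU sV]]] := two_dipaths US.
have ham s : perm_eq s S -> sorted (@arc D) s -> exists x y, dipath S x y.
  move=> sS ss; have sn : s != [::] by move: Sn; rewrite -!size_eq0 (perm_size sS).
  case: s sn ss sS => // x s _ xs sS; exists x, (last x s).
  by exists s.
have := strip_heads (B := [::]) (P := U) (Q := V); rewrite !cats0.
case=> // A [P [Q [pl sP sQ ok]]]; rewrite !cats0 in sP sQ.
have [B [P' [Q' [P2 [Q2 [pl' sP' sQ' [PE QE] ok']]]]]] := strip_lasts sP sQ.
case: P' pl' sP' PE ok' => [|p P'] pl' sP' PE ok'.
  by left; apply: (ham (A ++ Q' ++ B)) => //; perm_lia pl pl' UV.
case: Q' pl' sQ' QE ok' => [|q Q'] pl' sQ' QE ok'.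
  by left; apply: (ham (A ++ (p :: P') ++ B)) => //; perm_lia pl pl' UV.
right; exists A, (p :: P'), (q :: Q'), B.
exists (head p (A ++ p :: P')), (head q (A ++ q :: Q')), (last p (P' ++ B)), (last q (Q' ++ B)).
exists p, (last p P'), q, (last q Q'); split.
- by perm_lia pl pl' UV.
- split.
  + move: sP'; rewrite catA => /cat_sorted2[/(@sorted_dipath _ p) + _].
    by rewrite last_cat; apply; case: (A).
  + move: sQ'; rewrite catA => /cat_sorted2[/(@sorted_dipath _ q) + _].
    by rewrite last_cat; apply; case: (A).
  + by have /cat_sorted2[_ d] := sP'; exists (P' ++ B).
  + by have /cat_sorted2[_ d] := sQ'; exists (Q' ++ B).
- by rewrite !mem_head !mem_last.
- by move: ok; rewrite PE QE.
- by [].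
Qed.

(** * Closing up a Hamilton orcycle *)

Section Separation.

Variables X S Y : seq D.

Hypothesis D3 : 2 < #|D|.
Hypothesis XSY : perm_eq (X ++ S ++ Y) (enum D).
Hypothesis cX : clique X.
Hypothesis cY : clique Y.
Hypothesis cXS : complete X S.
Hypothesis X0 : X != [::].
Hypothesis S2 : 1 < size S.
Hypothesis SY : {in S, forall s, has (adj s) Y}.

Lemma uniq_XSY : uniq (X ++ S ++ Y).
Proof. by rewrite (perm_uniq XSY) enum_uniq. Qed.

Lemma uniq_S : uniq S.
Proof. by have := uniq_XSY; rewrite !cat_uniq => /and3P[_ _ /andP[]]. Qed.

Lemma uniq_Y : uniq Y.
Proof. by have := uniq_XSY; rewrite !cat_uniq => /and3P[_ _ /and3P[]]. Qed.

Lemma neq_SY s y : s \in S -> y \in Y -> s != y.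
Proof.
have := uniq_XSY; rewrite !cat_uniq => /and3P[_ _ /and3P[_ /hasPn SYd _]].
by move=> sS /SYd; apply: contraNneq => <-.
Qed.

Lemma adj_XS x s : x \in X -> s \in S -> adj x s.
Proof. exact: (allrelP cXS). Qed.

Lemma complete_X l : {subset l <= S} -> complete X l.
Proof. by move=> lS; apply/allrelP=> x s xX /lS; exact: adj_XS. Qed.

Lemma nonadj_common s s' y : s \in S -> s' \in S -> s != s' -> ~~ adj s s' -> y \in Y ->
  adj s y || adj s' y.
Proof.
move=> sS s'S ss' nadj yY.
by have := adj3 ss' (neq_SY s'S yY) (neq_SY sS yY); rewrite (negbTE nadj) /= orbC.
Qed.

Lemma nonadj_cover s s' : s \in S -> s' \in S -> s != s' -> ~~ adj s s' ->
  exists y y', [/\ adj s y, adj s' y' & orpath Y y y' 1].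
Proof.
move=> sS s'S ss' nadj; apply: orpath_clique_cover (SY sS) (SY s'S) => // y.
exact: nonadj_common.
Qed.

Lemma adj_Y_singleton s y0 : s \in S -> all (fun y => adj s y ==> (y == y0)) Y -> adj s y0.
Proof.
by move=> sS /allP sY; have /hasP[y yY sy] := SY sS; have := sY y yY; rewrite sy => /eqP<-.
Qed.

Lemma neq_dipath_ends w w' : dipath S w w' -> w != w'.
Proof.
case=> s [sS _ ls]; have := S2; rewrite -(perm_size sS).
have : uniq (w :: s) by rewrite (perm_uniq sS) uniq_S.
case/lastP: s {sS} ls => // s z; rewrite last_rcons => -> /andP[] + _ _.
by rewrite mem_rcons inE negb_or => /andP[].
Qed.

(** [X] is complete to [S] and is put right after [w]. Its two junctions, the two of [Y] and one
    backward arc inside [Y] add up to five. *)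
Lemma closed_nonadj_ends w w' y y' : dipath S w w' -> adj w' y -> adj w y' ->
  orpath Y y y' 1 -> good_cycle.
Proof.
move=> dS w'y wy' oY; have nall : ~~ all (pred1 w) S.
  apply/allPn; exists w'; first exact: dipath_last dS.
  by rewrite /= eq_sym neq_dipath_ends.
have [l1 [l2 [a [b [lS [d1 d2] _ _ _]]]]] := dipath_first_change (P := pred1 w) dS (eqxx w) nall.
have [x [x' dX]] := dipath_clique cX X0.
have o2 : orpath (l1 ++ X ++ l2) w w' 2.
  apply: orpath_cat (dipath_orpath d1) (orpath_cat (dipath_orpath dX) (dipath_orpath d2) _) _.
    apply: adj_XS (dipath_last dX) _.
    by rewrite -(perm_mem lS) mem_cat (dipath_head d2) orbT.
  rewrite adjC; apply: adj_XS (dipath_head dX) _.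
  by rewrite -(perm_mem lS) mem_cat (dipath_last d1).
by apply: orpaths_closed D3 _ o2 oY w'y _ _ => //; [perm_lia XSY lS|rewrite adjC].
Qed.

(** The count is one backward arc from [E] to [F], two inside [Y] and two at the junctions of [Y].
    [Z] stands for the part of [X] not yet placed in [E] or [F]. *)
Lemma junction E F Z e e' f f' y y' : perm_eq (E ++ F ++ Z) (X ++ S) ->
  clique Z -> complete Z E -> complete Z F ->
  dipath E e e' -> dipath F f f' -> adj e' f -> y \in Y -> y' \in Y -> y != y' ->
  adj f' y -> adj e y' ->
  good_cycle \/
  exists z, [/\ z \in Z, forall a, a \in E -> ~~ arc a z,
    forall a, a \in F -> ~~ arc z a &
    forall a x, a \in E -> x \in Z -> arc a x -> ~~ arc x z].
Proof.
move=> pl cZ cZE cZF dE dF e'f yY y'Y yy' f'y ey'.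
have [oEF|] := dipath_junction cZ cZE cZF dE dF e'f; [left|by right].
apply: orpaths_closed D3 _ oEF (orpath_clique cY yY y'Y yy') f'y _ _ => //.
  by perm_lia XSY pl.
by rewrite adjC.
Qed.

(* No arc could join the obstructions at the two junctions, although [X] is a clique. *)
Lemma two_junctions E F E' F' e1 e2 f1 f2 e1' e2' f1' f2' a b y1 y2 y1' y2' :
  perm_eq (E ++ F) S -> perm_eq (E' ++ F') S ->
  dipath E e1 e2 -> dipath F f1 f2 -> adj e2 f1 ->
  dipath E' e1' e2' -> dipath F' f1' f2' -> adj e2' f1' ->
  a \in E -> a \in F' -> b \in E' -> b \in F ->
  y1 \in Y -> y2 \in Y -> y1 != y2 -> adj f2 y1 -> adj e1 y2 ->
  y1' \in Y -> y2' \in Y -> y1' != y2' -> adj f2' y1' -> adj e1' y2' ->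
  good_cycle.
Proof.
move=> EF EF' dE dF ef dE' dF' ef' aE aF' bE' bF.
move=> Y1 Y2 y12 fy1 ey2 Y1' Y2' y12' fy1' ey2'.
have aS : a \in S by rewrite -(perm_mem EF) mem_cat aE.
have bS : b \in S by rewrite -(perm_mem EF) mem_cat bF orbT.
have sub U V : perm_eq (U ++ V) S -> {subset U <= S} /\ {subset V <= S}.
  by move=> UV; split=> z zU; rewrite -(perm_mem UV) mem_cat zU ?orbT.
have [[ES FS] [E'S F'S]] := (sub _ _ EF, sub _ _ EF').
have pEF : perm_eq (E ++ F ++ X) (X ++ S) by perm_lia EF.
have pEF' : perm_eq (E' ++ F' ++ X) (X ++ S) by perm_lia EF'.
have [//|[z [zX zE zF Ez]]] := junction pEF cX (complete_X ES) (complete_X FS)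
  dE dF ef Y1 Y2 y12 fy1 ey2.
have [//|[z' [z'X z'E z'F' E'z']]] := junction pEF' cX (complete_X E'S) (complete_X F'S)
  dE' dF' ef' Y1' Y2' y12' fy1' ey2'.
(* The arc from [a], a vertex of [E], to [z'] excludes an arc from [z'] to [z]; likewise the arc
   from [b], a vertex of [E'], to [z] excludes one from [z] to [z']. *)
have az' : arc a z' by apply: adj_arcN (z'F' a aF'); exact: adj_XS.
have bz : arc b z by apply: adj_arcN (zF b bF); exact: adj_XS.
have zz' : z != z' by apply: contraTneq az' => <-; exact: zE.
have := clique_adj cX zX z'X zz'.
by rewrite /adj /= (negbTE (Ez a z' aE z'X az')) orbF (negbTE (E'z' b z bE' zX bz)).
Qed.

(** * The case of a Hamilton directed path of [S] *)

Lemma sub_perm_cat l1 l2 : perm_eq (l1 ++ l2) S -> {subset l1 <= S} /\ {subset l2 <= S}.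
Proof. by move=> pl; split=> s sl; rewrite -(perm_mem pl) mem_cat sl ?orbT. Qed.

Lemma all_implyN (P Q : pred D) l :
  (~~ all (fun y => P y ==> Q y) l) = has (fun y => P y && ~~ Q y) l.
Proof. by rewrite -has_predC; apply: eq_has => y /=; rewrite negb_imply. Qed.

(** The edges between [S] and [Y] do not all meet in one vertex of [Y]; such a vertex would be a cut
    vertex when [Y] has others. *)
Hypothesis Ybig : forall y0, exists2 s, s \in S & has (fun y => adj s y && (y != y0)) Y.

(** If [w] has a single neighbour [y0] in [Y], the cut precedes the first vertex with another
    neighbour. Otherwise it follows [w], which has two neighbours to choose from. *)
Lemma change_of_neighbours w w' : dipath S w w' ->
  exists l1 l2 a b y y', [/\ perm_eq (l1 ++ l2) S, dipath l1 w a /\ dipath l2 b w',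
    arc a b, adj a y /\ adj b y' & [/\ y \in Y, y' \in Y & y != y']].
Proof.
move=> dS; have wS := dipath_head dS.
have /hasP[y0 Yy0 wy0] := SY wS.
pose P s := all (fun y => adj s y ==> (y == y0)) Y.
have [Pw|] := boolP (P w).
  have nall : ~~ all P S.
    by have [s sS] := Ybig y0; rewrite -all_implyN => ns; apply/allPn; exists s.
  have [l1 [l2 [a [b [pl [d1 d2] ab /allP Pl1 nPb]]]]] := dipath_first_change dS Pw nall.
  move: nPb; rewrite all_implyN => /hasP[y yY /andP[by_ yy0]].
  exists l1, l2, a, b, y0, y; rewrite eq_sym; split=> //; split=> //.
  apply: adj_Y_singleton (Pl1 _ (dipath_last d1)).
  by apply: (sub_perm_cat pl).1; exact: dipath_last d1.
rewrite all_implyN => /hasP[y1 Yy1 /andP[wy1 y10]].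
have nall : ~~ all (pred1 w) S.
  apply/allPn; exists w'; first exact: dipath_last dS.
  by rewrite /= eq_sym neq_dipath_ends.
have [l1 [l2 [a [b [pl [d1 d2] ab /allP l1w _]]]]] :=
  dipath_first_change (P := pred1 w) dS (eqxx w) nall.
have aw : a = w by apply/eqP; apply: l1w; exact: dipath_last d1.
have /hasP[y yY by_] := SY ((sub_perm_cat pl).2 _ (dipath_head d2)).
rewrite {}aw in d1 ab.
have [E|ne] := eqVneq y y0.
  by exists l1, l2, w, b, y1, y; split=> //; split=> //; rewrite E.
by exists l1, l2, w, b, y0, y; split=> //; split=> //; rewrite eq_sym.
Qed.

(* If both ends [w] and [w'] have the only neighbour [y0] in [Y], cut the dipath at the first and
   the last change of the neighbourhood in [Y] into [A B C]. The obstructions satisfy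
   A -> z -> BC and AB -> z' -> C, so [A z' C] and [z B] are dipaths as well; the obstruction [v]
   for these two gives the dipaths [B v] and [A z z' C] (or [A z' z C]), whose obstruction
   could not be adjacent to [v]. *)
Lemma hamilton_dipath_good w w' : dipath S w w' -> good_cycle.
Proof.
move=> dS; have [wS w'S] := (dipath_head dS, dipath_last dS).
have [ww'|nww'] := boolP (adj w' w); last first.
  have [|y [y' [wy w'y' oY]]] := nonadj_cover w'S wS _ nww'.
    by rewrite eq_sym neq_dipath_ends.
  exact: closed_nonadj_ends dS wy w'y' oY.
have [[y1 [y2 [Y1 Y2 wy1 wy2 y12]]]|[y0 Y0 wY]] := distinct_representatives (SY wS) (SY w'S).
  have [l1 [l2 [a [b [y [y' [pl [d1 d2] ab [ay by'] [yY y'Y yy']]]]]]]] :=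
    change_of_neighbours dS.
  have pl' : perm_eq (l2 ++ l1) S by perm_lia pl.
  (* One junction is at [w' w], with [Y] between [a] and [b]; the other is at [a b], with [Y]
     between [w'] and [w]. *)
  apply: (two_junctions pl' pl d2 d1 ww' d1 d2 (arc_adj ab) (dipath_head d2)
    (dipath_head d2) (dipath_head d1) (dipath_head d1) yY y'Y yy' ay by' Y2 Y1 _ wy2 wy1).
  by rewrite eq_sym.
(* From here on [P s] means that [y0] is the only neighbour of [s] in [Y]. Both cuts separate a
   vertex with [P] from one without, which yields distinct neighbours. *)
pose P s := all (fun y => adj s y ==> (y == y0)) Y.
have Pw : P w by apply/allP=> y yY; rewrite (wY y yY).1 implybb.
have Pw' : P w' by apply/allP=> y yY; rewrite (wY y yY).2 implybb.
have PY s : s \in S -> P s -> adj s y0 by move=> sS; exact: adj_Y_singleton.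
have nall : ~~ all P S.
  by have [s sS] := Ybig y0; rewrite -all_implyN => ns; apply/allPn; exists s.
have [A [BC [a' [b [pl [dA dBC] ab /allP PA nPb]]]]] := dipath_first_change dS Pw nall.
have nallBC : ~~ all P BC by apply/allPn; exists b => //; exact: dipath_head dBC.
have [B [C [b' [c [pl' [dB dC] bc nPb' /allP PC]]]]] := dipath_last_change dBC Pw' nallBC.
have [AS BCS] := sub_perm_cat pl.
have BBC : {subset B <= BC} by move=> s sB; rewrite -(perm_mem pl') mem_cat sB.
have CBC : {subset C <= BC} by move=> s sB; rewrite -(perm_mem pl') mem_cat sB orbT.
have BS : {subset B <= S} by move=> s /BBC/BCS.
have CS : {subset C <= S} by move=> s /CBC/BCS.
move: nPb nPb'; rewrite !all_implyN => /hasP[y1 Y1 /andP[by1 y10]] /hasP[y2 Y2 /andP[by2 y20]].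
have a'y0 : adj a' y0 by apply: PY (PA _ (dipath_last dA)); exact/AS/(dipath_last dA).
have cy0 : adj c y0 by apply: PY (PC _ (dipath_head dC)); exact/CS/(dipath_head dC).
have [wy0 w'y0] := (PY w wS Pw, PY w' w'S Pw').
have cXl := complete_X.
have y01 : y0 != y1 by rewrite eq_sym.
have p1 : perm_eq (BC ++ A ++ X) (X ++ S) by perm_lia pl.
have [//|[z [zX zBC zA _]]] := junction p1 cX (cXl _ BCS) (cXl _ AS) dBC dA ww' Y0 Y1 y01 a'y0 by1.
have dAB : dipath (A ++ B) w b' by exact: dipath_cat dA dB ab.
have ABS : {subset A ++ B <= S} by move=> s; rewrite mem_cat => /orP[/AS|/BS].
have p2 : perm_eq (C ++ (A ++ B) ++ X) (X ++ S) by perm_lia pl pl'.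
have [//|[z' [z'X z'C z'AB _]]] := junction p2 cX (cXl _ CS) (cXl _ ABS) dC dAB ww' Y2 Y0 y20 by2 cy0.
have bBC := dipath_head dBC; have bB := dipath_head dB.
have adjSX s x : s \in S -> x \in X -> adj s x by move=> sS xX; rewrite adjC adj_XS.
have bz' : arc b z'.
  by apply: adj_arcN (z'AB b _); rewrite ?mem_cat ?bB ?orbT //; apply: adj_XS => //; exact: BS.
have zz' : z' != z by apply: contraTneq bz' => ->; exact: zBC.
have pX := perm_to_rem zX; set X1 := rem z X in pX.
have z'X1 : z' \in X1 by move: z'X; rewrite (perm_mem pX) inE (negbTE zz').
have pX1 := perm_to_rem z'X1; set X2 := rem z' X1 in pX1.
have pX' : perm_eq X (z :: z' :: X2) by perm_lia pX pX1.
have := cX; rewrite (clique_perm pX') => /= /and3P[/andP[zaz' zX2] z'X2 cX2].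
have a'A := dipath_last dA; have b'B := dipath_last dB.
have cC := dipath_head dC; have w'C := dipath_last dC.
have a'z' : arc a' z'.
  by apply: adj_arcN (z'AB a' _); rewrite ?mem_cat ?a'A //; apply: adj_XS => //; exact: AS.
have z'c : arc z' c by apply: adj_arcN (z'C c cC); exact/(adjSX _ _ (CS _ cC)).
have zb : arc z b by apply: adj_arcN (zBC b bBC); exact/(adjSX _ _ (BS _ bB)).
have zc : arc z c by apply: adj_arcN (zBC c (CBC _ cC)); exact/(adjSX _ _ (CS _ cC)).
have a'z : arc a' z by apply: adj_arcN (zA a' a'A); exact/(adj_XS zX)/AS.
have dE3 : dipath (A ++ [:: z'] ++ C) w w'.
  exact: dipath_cat dA (dipath_cat (dipath1 z') dC z'c) a'z'.
have dF3 : dipath ([:: z] ++ B) z b' by exact: dipath_cat (dipath1 z) dB zb.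
have X2X : {subset X2 <= X} by move=> x xX; rewrite (perm_mem pX') !inE xX !orbT.
have cX2l l : {subset l <= S} -> complete X2 l.
  by move=> lS; apply/allrelP=> x s /X2X xX /lS; exact: adj_XS.
have p3 : perm_eq ((A ++ [:: z'] ++ C) ++ ([:: z] ++ B) ++ X2) (X ++ S).
  by perm_lia pl pl' pX'.
have w'z : adj w' z by exact: adjSX.
have cE3 : complete X2 (A ++ [:: z'] ++ C).
  by rewrite !complete_catr complete1r z'X2 !cX2l.
have cF3 : complete X2 ([:: z] ++ B).
  by rewrite complete_catr complete1r zX2 cX2l.
have [//|[v [vX2 vE vF Ev]]] := junction p3 cX2 cE3 cF3 dE3 dF3 w'z Y2 Y0 y20 by2 wy0.
have vX := X2X v vX2.
have pX2 := perm_to_rem vX2; set X3 := rem v X2 in pX2.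
have := cX2; rewrite (clique_perm pX2) => /= /andP[vX3 cX3].
have b'v : arc b' v.
  by apply: adj_arcN (vF b' _); rewrite ?mem_cat ?b'B ?orbT //; apply: adj_XS => //; exact: BS.
have dE4 : dipath (B ++ [:: v]) b v by exact: dipath_cat dB (dipath1 v) b'v.
have dF4 : dipath (A ++ [:: z; z'] ++ C) w w'.
  have [arczz'|arcz'z] := orP zaz'.
    by apply: dipath_cat dA (dipath_cat (y := z') _ dC z'c) a'z; exists [:: z']; rewrite /= arczz'.
  apply: (dipath_perm (l := A ++ [:: z'; z] ++ C)); first by perm_lia.
  by apply: dipath_cat dA (dipath_cat (y := z) _ dC zc) a'z'; exists [:: z]; rewrite /= arcz'z.
have X3X2 : {subset X3 <= X2} by move=> x xX; rewrite (perm_mem pX2) inE xX orbT.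
have cX3l l : {subset l <= S} -> complete X3 l.
  by move=> lS; apply/allrelP=> x s /X3X2/X2X xX /lS; exact: adj_XS.
have p4 : perm_eq ((B ++ [:: v]) ++ (A ++ [:: z; z'] ++ C) ++ X3) (X ++ S).
  by perm_lia pX2 p3.
have vw : adj v w by apply: adj_XS.
have cE4 : complete X3 (B ++ [:: v]).
  by rewrite complete_catr complete1r vX3 cX3l.
have cF4 : complete X3 (A ++ [:: z; z'] ++ C).
  rewrite -[[:: z; z']]/([:: z] ++ [:: z']) !complete_catr !complete1r !cX3l //= andbT.
  by apply/andP; split; apply/allP=> x /X3X2; [exact: (allP zX2)|exact: (allP z'X2)].
have [//|[v' [v'X3 v'E v'F _]]] := junction p4 cX3 cE4 cF4 dE4 dF4 vw Y0 Y1 y01 w'y0 by1.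
have v'X2 := X3X2 _ v'X3.
(* As [w'] lies on [A z' C], its arc to [v'] excludes an arc from [v'] to [v]. The opposite arc is
   excluded because [v] lies on [B v]. *)
have w'v' : arc w' v'.
  by apply: adj_arcN (v'F w' _); rewrite ?mem_cat ?w'C ?orbT //; apply: adj_XS => //; exact: X2X.
have nv'v : ~~ arc v' v by apply: Ev w'v'; rewrite // !mem_cat w'C !orbT.
have nvv' : ~~ arc v v' by apply: v'E; rewrite mem_cat mem_head orbT.
by have := allP vX3 v' v'X3; rewrite /adj /= (negbTE nv'v) (negbTE nvv').
Qed.

(** * The case of two branches with common stems *)

Lemma neq_cat l1 l2 x y : perm_eq (l1 ++ l2) S -> x \in l1 -> y \in l2 -> x != y.
Proof.
move=> pl xl yl; have := uniq_S; rewrite -(perm_uniq pl) cat_uniq => /and3P[_ /hasPn h _].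
by apply: contraTneq xl => ->; exact: h.
Qed.

(** The cycle runs through [A P], [Y], [Q B] and [X]: four junctions and one backward arc inside
    [Y]. *)
Lemma fork_closed A P Q B a1 a2 b1 b2 p p' q q' y y' :
  fork S A P Q B a1 a2 b1 b2 p p' q q' ->
  adj p' y -> adj y' q -> orpath Y y y' 1 -> good_cycle.
Proof.
case=> pl [dAP _ _ dQB] _ _ _ p'y y'q oY.
have [x [x' dX]] := dipath_clique cX X0.
have [memAP memQB] : {subset A ++ P <= S} /\ {subset Q ++ B <= S}.
  by apply: sub_perm_cat; perm_lia pl.
have o3 : orpath ((A ++ P) ++ Y ++ (Q ++ B)) a1 b2 3.
  exact: orpath_cat (dipath_orpath dAP) (orpath_cat oY (dipath_orpath dQB) y'q) p'y.
apply: orpaths_closed D3 _ o3 (dipath_orpath dX) _ _ _ => //; first by perm_lia XSY pl.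
  by rewrite adjC adj_XS ?(dipath_head dX) //; exact/memQB/(dipath_last dQB).
by rewrite adj_XS ?(dipath_last dX) //; exact/memAP/(dipath_head dAP).
Qed.

(** If [b1] and [a2] are nonadjacent, [Y] joins them with one backward arc inside, and the cycle
    runs through [A Q], [X], [P B] and [Y]. *)
Lemma fork_link A P Q B a1 a2 b1 b2 p p' q q' :
  fork S A P Q B a1 a2 b1 b2 p p' q q' -> good_cycle \/ adj b1 a2.
Proof.
case=> pl [_ dAQ dPB _] _ _ _; have [|nadj] := boolP (adj b1 a2); [by right|left].
have pl' : perm_eq ((A ++ Q) ++ (P ++ B)) S by perm_lia pl.
have [memAQ memPB] := sub_perm_cat pl'.
have [x [x' dX]] := dipath_clique cX X0.
have a2S := memAQ _ (dipath_head dAQ); have b1S := memPB _ (dipath_last dPB).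
have ne : b1 != a2 by rewrite eq_sym (neq_cat pl' (dipath_head dAQ) (dipath_last dPB)).
have [y [y' [b1y a2y' oY]]] := nonadj_cover b1S a2S ne nadj.
have o2 : orpath ((A ++ Q) ++ X ++ (P ++ B)) a2 b1 2.
  apply: orpath_cat (dipath_orpath dAQ)
    (orpath_cat (dipath_orpath dX) (dipath_orpath dPB) _) _.
    by rewrite adj_XS ?(dipath_last dX) //; exact/memPB/(dipath_head dPB).
  by rewrite adjC adj_XS ?(dipath_head dX) //; exact/memAQ/(dipath_last dAQ).
by apply: orpaths_closed D3 _ o2 oY b1y _ _; rewrite 1?adjC //; perm_lia XSY pl.
Qed.

Lemma fork_same_neighbour A P Q B a1 a2 b1 b2 p p' q q' y0 :
  fork S A P Q B a1 a2 b1 b2 p p' q q' -> adj b1 a2 -> y0 \in Y ->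
  {in Y, forall y, (adj p y = (y == y0)) * (adj q' y = (y == y0))} -> good_cycle.
Proof.
move=> F b1a2 Y0 N; have [pl [dAP dAQ dPB dQB] [pP p'P qQ q'Q] pq p'q'] := F.
have memS l x : x \in l -> {subset l <= A ++ P ++ Q ++ B} -> x \in S.
  by move=> xl /(_ x xl); rewrite (perm_mem pl).
have [pS p'S] : p \in S /\ p' \in S.
  by split; apply: (memS P) => // z zP; rewrite !mem_cat zP orbT.
have [qS q'S] : q \in S /\ q' \in S.
  by split; apply: (memS Q) => // z zQ; rewrite !mem_cat zQ !orbT.
have pl' : perm_eq (P ++ (A ++ Q ++ B)) S by perm_lia pl.
have neP z w : z \in P -> w \in Q -> z != w.
  by move=> zP wQ; apply: neq_cat pl' zP _; rewrite !mem_cat wQ orbT.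
have Nq y : y \in Y -> y != y0 -> adj q y.
  move=> yY yy0; have := nonadj_common pS qS (neP _ _ pP qQ) pq yY.
  by rewrite (N y yY).1 (negbTE yy0).
have Np' y : y \in Y -> y != y0 -> adj p' y.
  move=> yY yy0; have := nonadj_common p'S q'S (neP _ _ p'P q'Q) p'q' yY.
  by rewrite orbC (N y yY).2 (negbTE yy0).
have close y y' : adj p' y -> adj q y' -> orpath Y y y' 1 -> good_cycle.
  by move=> p'y qy'; apply: fork_closed F p'y _; rewrite adjC.
have YE := perm_to_rem Y0.
(* By nonadjacency, [q] and [p'] see all of [Y] except possibly [y0]. A suitable traversal of [Y]
   from [p'] to [q] is immediate if [Y] has one vertex and avoids [y0] at its ends if there are
   three or more; two vertices need more care. *)
case YE': (rem y0 Y) YE => [|y1 R] YE.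
  have Yy y : y \in Y -> y = y0 by rewrite (perm_mem YE) inE => /eqP.
  have /hasP[y yY p'y] := SY p'S; have /hasP[y' y'Y qy'] := SY qS.
  apply: close p'y qy' _; rewrite (Yy y yY) (Yy y' y'Y).
  by apply: orpath_perm (orpath_le _ (orpath1 y0)); rewrite // perm_sym.
have Y1 : y1 \in Y by rewrite (perm_mem YE) !inE eqxx orbT.
have y10 : y1 != y0.
  by have := uniq_Y; rewrite (perm_uniq YE) /= inE negb_or eq_sym => /andP[/andP[]].
case: R YE' YE => [|y2 R] _ YE; last first.
  have [|y [y' [yY y'Y yy0 y'y0 oY]]] := orpath_clique_avoid y0 cY uniq_Y.
    by rewrite (perm_size YE).
  exact: close (Np' y yY yy0) (Nq y' y'Y y'y0) oY.
have y1y0 : adj y1 y0 := clique_adj cY Y1 Y0 y10.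
have oY01 : orpath Y y0 y1 1.
  apply: (orpath_perm (l := [:: y0] ++ [:: y1])); first by rewrite perm_sym.
  by apply: orpath_cat (orpath1 y0) (orpath1 y1) _; rewrite adjC.
have oY10 : orpath Y y1 y0 1.
  apply: (orpath_perm (l := [:: y1] ++ [:: y0])); first by perm_lia YE.
  by apply: orpath_cat (orpath1 y1) (orpath1 y0) _.
have [p'y0|p'y0] := boolP (adj p' y0).
  exact: close p'y0 (Nq y1 Y1 y10) oY01.
(* Now [Y] consists of [y0] and [y1], and [p'] misses [y0]. [Y] is inserted into [P B] where
   adjacency to [y0] first fails, and [A Q] absorbs all of [X]. *)
have nall : ~~ all (fun s => adj s y0) (P ++ B).
  by apply/allPn; exists p'; rewrite // mem_cat p'P.
have py0 : adj p y0 by rewrite (N y0 Y0).1 eqxx.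
have [l1 [l2 [a [b [plP [d1 d2] _ al1 bnot]]]]] :=
  dipath_first_change (P := fun s => adj s y0) dPB py0 nall.
have ay0 : adj a y0 := allP al1 a (dipath_last d1).
have PBS : {subset P ++ B <= S}.
  by move=> z zPB; apply: (memS _ _ zPB) => w; rewrite !mem_cat => /orP[]->; rewrite ?orbT.
have bS : b \in S.
  by apply: PBS; rewrite -(perm_mem plP) mem_cat (dipath_head d2) orbT.
have by1 : adj b y1.
  have /hasP[y] := SY bS; rewrite (perm_mem YE) !inE => /orP[]/eqP-> //.
  by rewrite (negbTE bnot).
have AQS : {subset A ++ Q <= S}.
  by move=> z zPB; apply: (memS _ _ zPB) => w; rewrite !mem_cat => /orP[]->; rewrite ?orbT.
have [x [x' [dAQX xE x'E]]] := dipath_grow cX (complete_X AQS) dAQ.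
have o2 : orpath (l1 ++ Y ++ l2) p b1 3.
  apply: orpath_cat (dipath_orpath d1) (orpath_cat oY01 (dipath_orpath d2) _) ay0.
  by rewrite adjC.
apply: orpaths_closed D3 _ o2 (dipath_orpath dAQX) _ _ _ => //.
- by perm_lia XSY pl plP.
- move: xE; rewrite inE => /orP[/eqP->//|xX]; rewrite adjC adj_XS //.
  exact/PBS/(dipath_last dPB).
move: x'E; rewrite inE => /orP[/eqP->|x'X]; last exact: adj_XS.
(* Neither [q'] nor [p] is adjacent to [y1], so they are adjacent to each other. *)
have q'p : q' != p by rewrite eq_sym neP.
have := adj3 q'p (neq_SY pS Y1) (neq_SY q'S Y1).
by rewrite (N y1 Y1).1 (N y1 Y1).2 (negbTE y10) !orbF.
Qed.

(** The junctions are [b1 a2], from [P B] to [A Q], and [b2 a1], from [Q B] to [A P]. The branches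
    exchange sides, so [p] and [q] can serve as the two common vertices in [two_junctions]. *)
Lemma fork_good A P Q B a1 a2 b1 b2 p p' q q' :
  fork S A P Q B a1 a2 b1 b2 p p' q q' -> good_cycle.
Proof.
move=> F; have F' := fork_sym F.
have [//|b1a2] := fork_link F; have [//|b2a1] := fork_link F'.
have [pl [dAP dAQ dPB dQB] [pP p'P qQ q'Q] pq p'q'] := F.
have memS l x : x \in l -> {subset l <= A ++ P ++ Q ++ B} -> x \in S.
  by move=> xl /(_ x xl); rewrite (perm_mem pl).
have [pS p'S] : p \in S /\ p' \in S.
  by split; apply: (memS P) => // z zP; rewrite !mem_cat zP orbT.
have [qS q'S] : q \in S /\ q' \in S.
  by split; apply: (memS Q) => // z zQ; rewrite !mem_cat zQ !orbT.
have [[y1 [y2 [Y1 Y2 py1 q'y2 y12]]]|[y0 Y0 N]] := distinct_representatives (SY pS) (SY q'S); last first.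
  exact: fork_same_neighbour F b1a2 Y0 N.
have [[y3 [y4 [Y3 Y4 qy3 p'y4 y34]]]|[y0 Y0 N]] := distinct_representatives (SY qS) (SY p'S); last first.
  exact: fork_same_neighbour F' b2a1 Y0 N.
have p1 : perm_eq ((P ++ B) ++ (A ++ Q)) S by perm_lia pl.
have p2 : perm_eq ((Q ++ B) ++ (A ++ P)) S by perm_lia pl.
rewrite eq_sym in y12; rewrite eq_sym in y34.
apply: (two_junctions (a := p) (b := q) p1 p2 dPB dAQ b1a2 dQB dAP b2a1 _ _ _ _
  Y2 Y1 y12 q'y2 py1 Y4 Y3 y34 p'y4 qy3).
- by rewrite mem_cat pP.
- by rewrite mem_cat pP orbT.
- by rewrite mem_cat qQ.
- by rewrite mem_cat qQ orbT.
Qed.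

End Separation.

End Orpaths.

(** * The upper bound *)

Section UpperBound.

Variable D : digraph.

Hypothesis D2c : two_connected D.
Hypothesis D_alpha : independence_number D <= 2.

Lemma D3 : 2 < #|D|.
Proof. by case: D2c. Qed.

Lemma adj_of_three (x y z : D) : x != y -> y != z -> x != z ->
  [|| adj x y, adj y z | adj x z].
Proof.
move=> xy yz xz; apply: contraTT D_alpha; rewrite !negb_or -ltnNge.
move=> /and3P[/andP[nxy nyx] /andP[nyz nzy] /andP[nxz nzx]].
have -> : 3 = #|[set x; y; z]|.
  by rewrite -setUA cardsU1 cards2 !inE negb_or xy xz yz.
apply: (@leq_bigmax_cond _ (@independent D) (fun S : {set D} => #|S|)).
apply/forall_inP => a; rewrite !inE -orbA => aE; apply/forall_inP => b; rewrite !inE -orbA.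
by case/or3P: aE => /eqP->; case/or3P=> /eqP->; rewrite // arc_irrefl.
Qed.

Lemma clique_uniq (l : seq D) : uniq l ->
  {in l &, forall x y, x != y -> adj x y} -> clique l.
Proof.
elim: l => //= x l IHl /andP[xl Ul] adl; apply/andP; split.
  apply/allP=> y yl; apply: adl; rewrite ?inE ?eqxx ?yl ?orbT //.
  by apply: contraNneq xl => ->.
by apply: IHl => // y z yl zl; apply: adl; rewrite inE ?yl ?zl orbT.
Qed.

Lemma connected_crossing (A : {set D}) (B : pred D) (x y : D) : connected_in A ->
  x \in A -> y \in A -> B x -> ~~ B y ->
  exists a b, [/\ a \in A, b \in A, B a, ~~ B b & adj a b].
Proof.
move=> cA xA yA Bx nBy; have /connectP[p xp yE] := cA x y xA yA.
rewrite {}yE {yA} in nBy; elim: p x xA Bx xp nBy => [|z p IHp] x xA Bx /=; first by rewrite Bx.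
case/andP=> /and3P[_ zA xz] zp nB.
have [Bz|nBz] := boolP (B z); first exact: IHp zp nB.
by exists x, z.
Qed.

(** Its size is largest at a vertex of minimum degree in the underlying simple graph. *)
Definition non_neighbours (x : D) : {set D} := [set y | (y != x) && ~~ adj x y].

Section MinimumDegree.

Variable u : D.
Hypothesis u_max : forall x : D, #|non_neighbours x| <= #|non_neighbours u|.

Let Y := enum (non_neighbours u).
Let Xset : {set D} := [set x | x \notin non_neighbours u & [forall y in non_neighbours u, ~~ adj x y]].
Let X := enum Xset.
Let S := enum (~: (Xset :|: non_neighbours u)).

Lemma all_adj_good : non_neighbours u = set0 -> good_cycle D.
Proof.
move=> Y0.
have adjD (x y : D) : x != y -> adj x y.
  move=> xy; apply: contraT => nxy; have : y \in non_neighbours x by rewrite inE eq_sym xy.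
  by have := u_max x; rewrite Y0 cards0 leqn0 cards_eq0 => /eqP->; rewrite inE.
have cD : clique (enum D) by apply: clique_uniq => [|x y _ _ /adjD //]; exact: enum_uniq.
have sz : 2 < size (enum D) by rewrite -cardE D3.
have [|x [y d]] := dipath_clique cD; first by move: sz; case: (enum D).
apply: (orpath_closed D3 (perm_refl _) (dipath_orpath d)) => //; apply: adjD.
rewrite eq_sym; case: d => s [sD _ ls]; have := perm_size sD.
have : uniq (x :: s) by rewrite (perm_uniq sD) enum_uniq.
case/lastP: s {sD} ls => [|s z]; first by move=> _ _ E; rewrite -E in sz.
by rewrite last_rcons => -> /andP[+ _] _; rewrite mem_rcons inE negb_or => /andP[].
Qed.

Lemma max_non_neighbours_good : non_neighbours u != set0 -> good_cycle D.
Proof.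
case/set0Pn=> y0 y0Y; have D3 := D3.
have XP x : x \in X = (x \notin non_neighbours u) && [forall y in non_neighbours u, ~~ adj x y].
  by rewrite mem_enum inE.
have XYn x y : x \in X -> y \in Y -> ~~ adj x y.
  by rewrite XP mem_enum => /andP[_ /forall_inP]; apply.
have XYd x y : x \in X -> y \in Y -> x != y.
  by rewrite XP mem_enum => /andP[xY _] yY; apply: contraNneq xY => ->.
have SP s : s \in S -> (s \notin X) /\ (s \notin Y).
  by rewrite !mem_enum in_setC in_setU negb_or => /andP[].
have cover x : [|| x \in X, x \in S | x \in Y].
  by rewrite !mem_enum in_setC in_setU; case: (x \in Xset); case: (x \in non_neighbours u).
have y0Y' : y0 \in Y by rewrite mem_enum.
have uX : u \in X.
  rewrite XP inE eqxx /=; apply/forall_inP => y; rewrite inE => /andP[] //.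
have XSY : perm_eq (X ++ S ++ Y) (enum D).
  apply: uniq_perm; rewrite ?enum_uniq //.
    rewrite !cat_uniq !enum_uniq /= andbT; apply/andP; split; apply/hasPn => z.
      rewrite mem_cat => /orP[/SP[]//|zY]; apply/negP => zX.
      by have := XYd z z zX zY; rewrite eqxx.
    by move=> zY; apply/negP => /SP[_ /negP].
  by move=> z; rewrite mem_enum !mem_cat cover.
have cX : clique X.
  apply: clique_uniq => [|x x' xX x'X xx']; first exact: enum_uniq.
  have := adj_of_three xx' (XYd _ _ x'X y0Y') (XYd _ _ xX y0Y').
  by rewrite (negbTE (XYn _ _ xX y0Y')) (negbTE (XYn _ _ x'X y0Y')) !orbF.
have cY : clique Y.
  apply: clique_uniq => [|y y' yY y'Y yy']; first exact: enum_uniq.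
  have := adj_of_three (XYd _ _ uX yY) yy' (XYd _ _ uX y'Y).
  by rewrite (negbTE (XYn _ _ uX yY)) (negbTE (XYn _ _ uX y'Y)) orbF.
have cXS : complete X S.
  apply/allrelP=> x s xX sS; have [sX sY] := SP s sS.
  (* [x] misses all of [Y], hence by maximality nothing else. *)
  have sub : non_neighbours u \subset non_neighbours x.
    apply/subsetP=> y yY; have yY' : y \in Y by rewrite mem_enum.
    by rewrite inE XYn // eq_sym XYd.
  have /eqP nnE : non_neighbours u == non_neighbours x by rewrite eqEcard sub u_max.
  move: sY; rewrite mem_enum nnE inE negb_and !negbK => /orP[/eqP sx|//].
  by rewrite sx xX in sX.
have SY : {in S, forall s, has (adj s) Y}.
  move=> s /SP[]; rewrite XP mem_enum negb_and => + sY; rewrite sY /= negb_forall_in.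
  by case/exists_inP=> y yY; rewrite negbK => sy; apply/hasP; exists y; rewrite ?mem_enum.
(* A path from [u] to [y0] leaves [X] at a vertex of [S]. Deleting [s1] and applying this again
   gives a second vertex of [S]. *)
have separated (A : {set D}) : connected_in A -> u \in A -> y0 \in A ->
    exists2 s, s \in A & s \in S.
  move=> cA uA y0A.
  have y0X : y0 \notin X by apply/negP => /XYd/(_ y0Y'); rewrite eqxx.
  have [a [b [_ bA aX bX ab]]] := connected_crossing (B := fun x => x \in X) cA uA y0A uX y0X.
  exists b => //; have := cover b; rewrite (negbTE bX) /= => /orP[//|bY].
  by have := XYn a b aX bY; rewrite ab.
have [_ cD cDv] := D2c.
have [s1 _ s1S] : exists2 s, s \in [set: D] & s \in S by apply: separated; rewrite ?inE.
have nS z : z \in X ++ Y -> s1 != z.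
  have [s1X s1Y] := SP _ s1S.
  by rewrite mem_cat => /orP[zX|zY]; [apply: contraNneq s1X => ->|apply: contraNneq s1Y => ->].
have [s2 s2v s2S] : exists2 s, s \in [set~ s1] & s \in S.
  by apply: separated; rewrite ?inE 1?eq_sym ?nS ?mem_cat ?uX ?y0Y' ?orbT.
have S2 : 1 < size S.
  have p1 := perm_to_rem s1S; rewrite (perm_size p1) /=.
  have : s2 \in rem s1 S by move: s2S; rewrite (perm_mem p1) inE; move: s2v; rewrite !inE => /negbTE->.
  by case: (rem s1 S).
have X0 : X != [::] by case: (X) uX.
have S0 : S != [::] by case: (S) s1S.
have US : uniq S := enum_uniq _.
have [[w [w' dS]]|[A [P [Q [B [a1 [a2 [b1 [b2 [p [p' [q [q' F]]]]]]]]]]]]] :=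
  hamilton_dipath_or_fork adj_of_three US S0; last first.
  exact: (fork_good adj_of_three D3 XSY cX cY cXS X0 SY F).
(* If [Y] is a single vertex, every vertex of [S] is adjacent to it, so it joins the ends of the
   path directly. *)
have [Y1|Y1] := leqP (size Y) 1.
  have YE : Y = [:: y0] by case: (Y) y0Y' Y1 => // y [] //; rewrite inE => /eqP->.
  have y0S s : s \in S -> adj s y0 by move=> /SY; rewrite YE /= orbF.
  apply: (closed_nonadj_ends D3 XSY cX cXS X0 S2 dS).
  - exact: y0S (dipath_last dS).
  - exact: y0S (dipath_head dS).
  - by rewrite YE; apply: (orpath_le (k := 0)) => //; exact: orpath1.
apply: (hamilton_dipath_good adj_of_three D3 XSY cX cY cXS X0 S2 SY _ dS) => y.
have [yY|nyY] := boolP (y \in Y); last first.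
  exists s1 => //; have /hasP[z zY s1z] := SY _ s1S; apply/hasP; exists z => //.
  by rewrite s1z; apply: contraNneq nyY => <-.
have [y1 y1Y y1y] : exists2 y1, y1 \in Y & y1 != y.
  have UY : uniq Y := enum_uniq _; have py := perm_to_rem yY.
  move: Y1 UY; rewrite (perm_size py) (perm_uniq py) /= => sz /andP[ynr _].
  case: (rem y Y) py sz ynr => // y1 r py _; rewrite inE negb_or eq_sym => /andP[y1y _].
  by exists y1; rewrite // (perm_mem py) !inE eqxx orbT.
have YnY x : x \in Y -> x \notin X ++ S.
  move=> xY; apply/negP; rewrite mem_cat => /orP[/XYd/(_ xY)|/SP[_]]; first by rewrite eqxx.
  by rewrite xY.
(* After deletion of [y], an edge still leads from [X] and [S] to the rest of [Y]; it starts in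
   [S]. *)
have [a [b [_ bA aXS bXS ab]]] : exists a b, [/\ a \in [set~ y], b \in [set~ y],
    a \in X ++ S, b \notin X ++ S & adj a b].
  apply: (connected_crossing (B := fun x => x \in X ++ S) (x := u) (y := y1)) => //.
  - by rewrite !inE XYd.
  - by rewrite !inE.
  - by rewrite mem_cat uX.
  - exact: YnY.
have bY : b \in Y.
  by have := cover b; rewrite orbA -mem_cat (negbTE bXS).
exists a; last by apply/hasP; exists b; rewrite // ab; move: bA; rewrite !inE.
by move: aXS; rewrite mem_cat => /orP[aX|//]; have := XYn a b aX bY; rewrite ab.
Qed.

End MinimumDegree.

Lemma good_cycle_exists : good_cycle D.
Proof.
have [x0 _] : exists x0 : D, x0 \in D by apply/card_gt0P; apply: leq_trans D3.
have [u _ umax] := @arg_maxnP D x0 predT (fun x => #|non_neighbours x|) isT.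
have u_max x : #|non_neighbours x| <= #|non_neighbours u| by exact: umax.
have [E|] := eqVneq (non_neighbours u) set0.
  exact: all_adj_good u_max E.
exact: max_non_neighbours_good u_max.
Qed.

End UpperBound.

(** * The lower bound *)

(* The vertices 0..3 span a tournament in which every Hamilton orpath from 0 to 1 has at least
   two backward arcs and every one from 1 to 0 at least one; 4..7 span a copy of it, and the
   only other arcs are (1, 4) and (5, 0). *)
Definition arc8 : rel nat := fun i j =>
  (i, j) \in [:: (1, 0); (1, 3); (2, 0); (2, 1); (2, 3); (3, 0);
                 (5, 4); (5, 7); (6, 4); (6, 5); (6, 7); (7, 4);
                 (1, 4); (5, 0)].

Definition adj8 : rel nat := fun i j => arc8 i j || arc8 j i.

Lemma arc8_irrefl : irreflexive (fun i j : 'I_8 => arc8 i j).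
Proof. by move=> [[|[|[|[|[|[|[|[|]]]]]]]]]. Qed.

Definition D8 : digraph := Digraph arc8_irrefl.

(** * Connectivity and independence number of the example *)

Lemma mem_iota_ord (n : nat) (i : 'I_n) : val i \in iota 0 n.
Proof. by rewrite mem_iota /= add0n ltn_ord. Qed.

Lemma independent8 : independence_number D8 <= 2.
Proof.
apply/bigmax_leqP=> S indS; rewrite leqNgt; apply/negP => /card_gt2P.
move=> [x [y [z [[xS yS zS] [xy yz zx]]]]].
have nadj (a b : D8) : a \in S -> b \in S -> ~~ adj8 a b.
  move=> aS bS; rewrite negb_or.
  by rewrite (forall_inP (forall_inP indS a aS)) // (forall_inP (forall_inP indS b bS)).
(* Quantification over vertices becomes [all] over [iota 0 8], which is settled by computation. *)
have /allP/(_ _ (mem_iota_ord x))/allP/(_ _ (mem_iota_ord y))/allP/(_ _ (mem_iota_ord z)) : all (fun a => all (fun b => all (fun c =>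
  [|| a == b, b == c, c == a, adj8 a b, adj8 b c | adj8 c a])
  (iota 0 8)) (iota 0 8)) (iota 0 8) by vm_compute.
rewrite !(negbTE (nadj _ _ _ _)) // !orbF.
by rewrite !val_eqE (negbTE xy) (negbTE yz) (negbTE zx).
Qed.

(** Consecutive vertices may coincide, so this allows up to three edges; that suffices even after
    the deletion of a vertex. *)
Definition walk8 (ok : pred nat) (i j : nat) : bool :=
  has (fun k => has (fun l => all ok [:: i; k; l; j] &&
    all (fun e => (e.1 == e.2) || adj8 e.1 e.2) [:: (i, k); (k, l); (l, j)])
   (iota 0 8)) (iota 0 8).

Lemma connected_in8 (A : {set D8}) (ok : pred nat) :
  (forall i : 'I_8, (i \in A) = ok i) ->
  all (fun i => all (fun j => ok i ==> ok j ==> walk8 ok i j) (iota 0 8)) (iota 0 8) ->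
  connected_in A.
Proof.
move=> Aok walks x y; rewrite !Aok => okx oky.
have /allP/(_ _ (mem_iota_ord x))/allP/(_ _ (mem_iota_ord y)) := walks; rewrite okx oky /=.
case/hasP=> k; rewrite mem_iota add0n => /andP[_ lt_k] /hasP[l].
rewrite mem_iota add0n => /andP[_ lt_l].
rewrite -[k]/(val (Ordinal lt_k)) -[l]/(val (Ordinal lt_l)).
move: (Ordinal lt_k) (Ordinal lt_l) => {lt_k lt_l}{}k {}l.
rewrite /= !andbT => /andP[/and4P[_ okk okl _] /and3P[xk kl ly]].
have step (a b : 'I_8) : ok a -> ok b -> (nat_of_ord a == b) || adj8 a b ->
    connect [rel u v : D8 | [&& u \in A, v \in A & adj u v]] a b.
  move=> oka okb /orP[/eqP/val_inj->|ab]; first exact: connect0.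
  by apply: connect1; rewrite /= !Aok oka okb.
exact: connect_trans (step _ _ okx okk xk) (connect_trans (step _ _ okk okl kl) (step _ _ okl oky ly)).
Qed.

Lemma two_connected8 : two_connected D8.
Proof.
split; first by rewrite card_ord.
- by apply: (@connected_in8 _ predT) => [i|]; [rewrite inE | vm_compute].
move=> v; apply: (@connected_in8 _ (predC1 (val v))) => [i|].
  by rewrite !inE -val_eqE.
have /allP/(_ _ (mem_iota_ord v)) : all (fun k => all (fun i => all (fun j =>
  (i != k) ==> (j != k) ==> walk8 (predC1 k) i j) (iota 0 8)) (iota 0 8)) (iota 0 8).
  by vm_compute.
by [].
Qed.

(* Exhaustive search: every way to complete an orpath ending in [cur], which already has [k]
   backward arcs, to a Hamilton orcycle through [rest] back to [first] has at least [m]. *)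
Fixpoint hamilton_ge (fuel : nat) (rest : seq nat) (first cur k m : nat) : bool :=
  if fuel is fuel'.+1 then
    all (fun x => adj8 cur x ==>
      hamilton_ge fuel' (rem x rest) first x (~~ arc8 cur x + k) m) rest
  else adj8 cur first ==> (m <= ~~ arc8 cur first + k).

Lemma hamilton_geP (s rest : seq nat) (first cur k m : nat) :
  perm_eq s rest -> hamilton_ge (size s) rest first cur k m ->
  path adj8 cur (rcons s first) -> m <= back arc8 cur (rcons s first) + k.
Proof.
elim: s rest cur k => [|x s IHs] rest cur k /=.
  by move=> _ h /andP[cf _]; rewrite cf /= in h; rewrite /back /= addn0.
move=> srest /allP h /andP[cx xs].
have xrest : x \in rest by rewrite -(perm_mem srest) mem_head.
have := h x xrest; rewrite cx /= => h'.
have ps : perm_eq s (rem x rest).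
  by rewrite -(perm_cons x) (permPl srest) perm_to_rem.
by have := IHs _ _ _ ps h' xs; rewrite /back /= addnCA addnA.
Qed.

Lemma back_map (T T' : Type) (f : T -> T') (r : rel T') (x : T) (s : seq T) :
  back (relpre f r) x s = back r (f x) (map f s).
Proof. by rewrite /back; elim: s x => //= y s IHs x; rewrite IHs. Qed.

(** A Hamilton orcycle uses both linking arcs. If they are forward, each tournament contributes two
    backward arcs; otherwise each contributes one, and the linking arcs are backward too. The search
    confirms the bound from every start. *)
Lemma hamilton8 : ~ exists c : seq D8, hamilton_orcycle c /\ backward_arcs c < 4.
Proof.
case=> -[|x s] [[[//]]] _ Us adj_s full; rewrite ltnNge => /negP; apply.
rewrite /backward_arcs count_next // (back_map val arc8) map_rcons.
have ps : perm_eq (map val s) (rem (val x) (iota 0 8)).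
  rewrite -(perm_cons (val x)); apply: perm_trans (perm_to_rem (mem_iota_ord x)).
  apply: uniq_perm; rewrite ?iota_uniq -?[val x :: _]/(map val (x :: s)) ?map_inj_uniq //; first exact: val_inj.
  move=> i; apply/mapP/idP=> [[j _ ->]|]; first exact: mem_iota_ord.
  rewrite mem_iota add0n => /andP[_ lt_i].
  by exists (Ordinal lt_i); first exact: full.
have sz_s : size (map val s) = 7.
  by rewrite (perm_size ps) size_rem ?mem_iota_ord // size_iota.
have /allP/(_ _ (mem_iota_ord x)) : all (fun i =>
  hamilton_ge 7 (rem i (iota 0 8)) i i 0 4) (iota 0 8) by vm_compute.
rewrite -{1}sz_s => /(hamilton_geP ps); rewrite addn0; apply.
by rewrite -map_rcons path_map.
Qed.

Theorem theorem1p3 :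
  (forall D : digraph,
     two_connected D -> independence_number D <= 2 ->
     exists c : seq D, hamilton_orcycle c /\ backward_arcs c <= 5) /\
  (exists D : digraph,
     [/\ two_connected D,
         independence_number D <= 2 &
         ~ exists c : seq D, hamilton_orcycle c /\ backward_arcs c < 4]).
Proof.
split; first by move=> D; exact: good_cycle_exists.
by exists D8; split; [exact: two_connected8|exact: independent8|exact: hamilton8].
Qed.
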